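(* Let $$x_0 = \frac{2}{3} -\frac{\sqrt[3]{44+12 \sqrt{69}}}{6} + \frac{10}{ 3 \sqrt[3]{44+12\sqrt{69}}},$$ and let $T_0$ be the triangle with vertices $(0,0)$, $(1,0)$ and $(x_0,1)$. Let $H$ be a (possibly degenerate) $o$-symmetric convex hexagon. If $H$ is weakly invariant, then $H$ is either a square, or similar to $\frac{1}{2}(T_0-T_0)$.
   Context: $o$ is the origin of $\mathbb{R}^2$; a set $K$ is $o$-symmetric if $K=-K$. A degenerate $o$-symmetric hexagon is an $o$-symmetric (nondegenerate) parallelogram; so a possibly degenerate $o$-symmetric convex hexagon is an $o$-symmetric convex polygon with nonempty interior that has either six or four vertices. $\frac12(T_0-T_0)=\{\frac12(p-q):p,q\in T_0\}$. Similarities may be orientation-reversing. Let $K$ be a plane convex body (compact convex set in $\mathbb{R}^2$ with nonempty interior). A rectangle $R$ (of arbitrary orientation) is circumscribed about $K$ if $K\subseteq R$ and every side of $R$ contains a point of $K$; let $a(R)\le b(R)$ denote the side lengths of $R$. $R$ is an extremal rectangle of $K$ if $R$ is circumscribed about $K$ and $\frac{a(R)}{b(R)}=\inf\{\frac{a(R')}{b(R')}: R' \text{ is a rectangle circumscribed about } K\}$. For an extremal rectangle $R$ of $K$, let $L$ be the line through $o$ parallel to the sides of $R$ of length $a(R)$; $f_{K,R}$ denotes the orthogonal affinity with axis $L$ and ratio $\frac{a(R)}{b(R)}$, i.e. the linear map fixing $L$ pointwise and multiplying vectors orthogonal to $L$ by $\frac{a(R)}{b(R)}$ (if $R$ is a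 square, $f_{K,R}$ is the identity). $K$ is weakly invariant if $f_{K,R}(K)$ is similar to $K$ for some extremal rectangle $R$ of $K$. *)

(* Defs.v *)
From mathcomp Require Import all_boot all_order all_algebra.
From mathcomp Require Import all_classical all_reals all_analysis.

Set Implicit Arguments.
Unset Strict Implicit.
Unset Printing Implicit Defensive.

Import Order.TTheory GRing.Theory Num.Theory.
Import numFieldNormedType.Exports.

Local Open Scope classical_set_scope.
Local Open Scope ring_scope.

(* The norm of the library on ['rV[R]_2] is the sup norm, so the Euclidean
   structure is introduced separately. *)
Definition dot (R : realType) (x y : 'rV[R]_2) : R := (x *m y^T) 0 0.

Definition enorm (R : realType) (x : 'rV[R]_2) : R := Num.sqrt (dot x x).

Definition pt (R : realType) (x y : R) : 'rV[R]_2 :=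
  \row_(i < 2) (if i == 0 then x else y).

Definition convex_hull (R : realType) (A : set 'rV[R]_2) : set 'rV[R]_2 :=
  smallest (@convex_set R 'rV[R]_2) A.

Definition extreme_points (R : realType) (A : set 'rV[R]_2) : set 'rV[R]_2 :=
  [set x | A x /\ forall y z (t : R), A y -> A z -> 0 < t < 1 ->
     x = t *: y + (1 - t) *: z -> y = x /\ z = x].

Definition convex_polygon (R : realType) (n : nat) (P : set 'rV[R]_2) : Prop :=
  [/\ (extreme_points P #= `I_n)%card,
      P = convex_hull (extreme_points P) &
      interior P !=set0].

Definition o_symmetric (R : realType) (A : set 'rV[R]_2) : Prop :=
  A = [set - x | x in A].

Definition o_symmetric_hexagon (R : realType) (H : set 'rV[R]_2) : Prop :=
  o_symmetric H /\ convex_polygon 6 H.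

(* An o-symmetric convex quadrangle is a parallelogram. *)
Definition degenerate_o_symmetric_hexagon (R : realType)
    (H : set 'rV[R]_2) : Prop :=
  o_symmetric H /\ convex_polygon 4 H.

(* Two records may present the same point set (four choices of the corner, and
   for a square also an exchange of the two directions); [short_len] and
   [long_len] depend only on the point set. *)
Record rectangle (R : realType) := Rectangle {
  corner : 'rV[R]_2;
  short_dir : 'rV[R]_2;
  long_dir : 'rV[R]_2;
  short_len : R;
  long_len : R;
  short_dir_unit : enorm short_dir = 1;
  long_dir_unit : enorm long_dir = 1;
  dir_orthogonal : dot short_dir long_dir = 0;
  short_len_gt0 : 0 < short_len;
  short_le_long : short_len <= long_len }.

Definition rect_set (R : realType) (Q : rectangle R) : set 'rV[R]_2 :=
  [set corner Q + s *: short_dir Q + t *: long_dir Q |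
     s in `[0, short_len Q] & t in `[0, long_len Q]].

Definition segment (R : realType) (p q : 'rV[R]_2) : set 'rV[R]_2 :=
  [set (1 - t) *: p + t *: q | t in `[0, 1]].

Definition rect_sides (R : realType) (Q : rectangle R) : set (set 'rV[R]_2) :=
  let p := corner Q in
  let u := short_len Q *: short_dir Q in
  let v := long_len Q *: long_dir Q in
  [set segment p (p + u); segment (p + v) (p + u + v);
       segment p (p + v); segment (p + u) (p + u + v)].

Definition aspect_ratio (R : realType) (Q : rectangle R) : R :=
  short_len Q / long_len Q.

Definition circumscribed (R : realType) (K : set 'rV[R]_2)
    (Q : rectangle R) : Prop :=
  K `<=` rect_set Q /\ forall S, rect_sides Q S -> K `&` S !=set0.

Definition extremal_rectangle (R : realType) (K : set 'rV[R]_2)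
    (Q : rectangle R) : Prop :=
  circumscribed K Q /\
  aspect_ratio Q = inf [set aspect_ratio Q' | Q' in circumscribed K].

(* For a unit vector [u]: fixes the line spanned by [u] pointwise and multiplies
   the vectors orthogonal to [u] by [k]. *)
Definition orthogonal_affinity (R : realType) (u : 'rV[R]_2) (k : R)
    (x : 'rV[R]_2) : 'rV[R]_2 :=
  dot x u *: u + k *: (x - dot x u *: u).

Definition rect_affinity (R : realType) (Q : rectangle R) :
    'rV[R]_2 -> 'rV[R]_2 :=
  orthogonal_affinity (short_dir Q) (aspect_ratio Q).

Definition similarity (R : realType) (g : 'rV[R]_2 -> 'rV[R]_2) : Prop :=
  exists2 c : R, 0 < c & forall x y, enorm (g x - g y) = c * enorm (x - y).

Definition similar_sets (R : realType) (A B : set 'rV[R]_2) : Prop :=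
  exists2 g, similarity g & g @` A = B.

Definition weakly_invariant (R : realType) (K : set 'rV[R]_2) : Prop :=
  exists2 Q, extremal_rectangle K Q & similar_sets (rect_affinity Q @` K) K.

Definition is_square (R : realType) (A : set 'rV[R]_2) : Prop :=
  exists2 Q : rectangle R, short_len Q = long_len Q & A = rect_set Q.

Definition half_difference_body (R : realType) (A : set 'rV[R]_2) :
    set 'rV[R]_2 :=
  [set 2^-1 *: (p - q) | p in A & q in A].

Definition x0 (R : realType) : R :=
  let c := (44 + 12 * Num.sqrt 69) `^ 3^-1 in
  2 / 3 - c / 6 + 10 / (3 * c).

Definition triangle_T0 (R : realType) : set 'rV[R]_2 :=
  convex_hull [set pt 0 0; pt 1 0; pt (x0 R) 1].

Arguments triangle_T0 : clear implicits.

(* Main.v *)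
(* Let k be the aspect ratio of the extremal rectangle R and A the composition of
   f_{H,R} with the linear part of a similarity mapping f_{H,R}(H) onto H; by
   symmetry the translation part is zero, so A permutes the vertices of H.

   If k = 1, all circumscribed rectangles are squares, i.e. the support function
   of H is invariant under the quarter turn. Evaluated at a longest vertex e it
   yields a vertex f orthogonal to e with |f| = |e|; a third pair of vertices is
   excluded by evaluating it at e + f and e - f.

   If k < 1, the relations A^2 = 1 and A^2 = -1 would force A to exchange the
   axes of R, which is incompatible with the side lengths of R. So H is a hexagon
   and A permutes the three pairs of opposite vertices cyclically; up to a sign,
   A^2 + A + 1 = 0. Extremality of R puts a pair of edges on the long sides of
   R, hence a vertex on the axis parallel to them. The matrix of A in the frame
   of R is (k a, -b; k b, a), and the circumscription conditions become
   a (1 + k) = -1, b^2 = 1, k (a^2 + 1) = 1, so that 1 + a is the root of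
   t^3 - 2 t^2 + 3 t - 1, i.e. x0. *)
Require Import Defs.
From mathcomp Require Import all_boot all_order all_algebra.
From mathcomp Require Import all_classical all_reals all_analysis.
From mathcomp Require Import ring lra.

Set Implicit Arguments.
Unset Strict Implicit.
Unset Printing Implicit Defensive.

Import Order.TTheory GRing.Theory Num.Theory.

Local Open Scope classical_set_scope.
Local Open Scope ring_scope.

(** * The Euclidean plane *)

Section Euclidean_plane.
Context {R : realType}.
Implicit Types (x y z u v : 'rV[R]_2) (a b t : R).

Lemma dotE x y : dot x y = x 0 0 * y 0 0 + x 0 1 * y 0 1.
Proof.
by rewrite /dot !mxE !big_ord_recl big_ord0 /= !mxE addr0; congr (_ * _ + _ * _);
  congr (_ _ _); apply: val_inj.
Qed.

Lemma rV2P x y : x 0 0 = y 0 0 -> x 0 1 = y 0 1 -> x = y.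
Proof.
move=> e0 e1; apply/rowP => -[[|[|//]] i].
- by rewrite (_ : Ordinal i = 0) //; apply: val_inj.
- by rewrite (_ : Ordinal i = 1) //; apply: val_inj.
Qed.

Lemma dotC x y : dot x y = dot y x. Proof. rewrite !dotE; ring. Qed.
Lemma dotDl x y z : dot (x + y) z = dot x z + dot y z.
Proof. rewrite !dotE !mxE; ring. Qed.
Lemma dotZl a x z : dot (a *: x) z = a * dot x z.
Proof. rewrite !dotE !mxE; ring. Qed.
Lemma dotNl x z : dot (- x) z = - dot x z.
Proof. rewrite !dotE !mxE; ring. Qed.
Lemma dotDr x y z : dot z (x + y) = dot z x + dot z y.
Proof. by rewrite dotC dotDl !(dotC z). Qed.
Lemma dotZr a x z : dot z (a *: x) = a * dot z x.
Proof. by rewrite dotC dotZl (dotC z). Qed.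
Lemma dotNr x z : dot z (- x) = - dot z x.
Proof. by rewrite dotC dotNl (dotC z). Qed.
Lemma dot0l x : dot 0 x = 0. Proof. by rewrite -(scale0r 0) dotZl mul0r. Qed.
Definition dotlin := (dotDl, dotNl, dotZl, dotDr, dotNr, dotZr).

Lemma dot_ge0 x : 0 <= dot x x.
Proof. by rewrite dotE addr_ge0// -expr2 sqr_ge0. Qed.

Lemma dot_eq0 x : (dot x x == 0) = (x == 0).
Proof.
apply/eqP/eqP => [|->]; last by rewrite dot0l.
rewrite dotE => h; apply: rV2P; rewrite mxE; nra.
Qed.

Lemma dot_gt0 x : x != 0 -> 0 < dot x x.
Proof. by move=> x0; rewrite lt_def dot_eq0 x0 dot_ge0. Qed.

Lemma enorm_ge0 x : 0 <= enorm x. Proof. exact: sqrtr_ge0. Qed.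

Lemma enorm_sqr x : enorm x ^+ 2 = dot x x.
Proof. by rewrite sqr_sqrtr// dot_ge0. Qed.

Lemma enorm_gt0 x : x != 0 -> 0 < enorm x.
Proof. by move=> x0; rewrite sqrtr_gt0 dot_gt0. Qed.

Lemma enorm1P x : enorm x = 1 <-> dot x x = 1.
Proof.
rewrite -enorm_sqr; split=> [->|]; first by rewrite expr1n.
by have := enorm_ge0 x; nra.
Qed.

Definition rot90 x : 'rV[R]_2 := pt (- x 0 1) (x 0 0).

Lemma dot_rot90r x : dot x (rot90 x) = 0.
Proof. rewrite dotE !mxE /=; ring. Qed.
Lemma dot_rot90_rot90 x y : dot (rot90 x) (rot90 y) = dot x y.
Proof. rewrite !dotE !mxE /=; ring. Qed.
Lemma rot90rot90 x : rot90 (rot90 x) = - x.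
Proof. by apply: rV2P; rewrite !mxE. Qed.
Lemma rot90Z a x : rot90 (a *: x) = a *: rot90 x.
Proof. by apply: rV2P; rewrite !mxE /= ?mulrN. Qed.
Lemma rot90D x y : rot90 (x + y) = rot90 x + rot90 y.
Proof. by apply: rV2P; rewrite !mxE /= ?opprD. Qed.
Lemma dot_sqr_rot90 x y : dot x y ^+ 2 + dot (rot90 x) y ^+ 2 = dot x x * dot y y.
Proof. rewrite !dotE !mxE /=; ring. Qed.

Section Frame.
Variables u v : 'rV[R]_2.
Hypotheses (u1 : dot u u = 1) (v1 : dot v v = 1) (uv0 : dot u v = 0).

Lemma frameE x : x = dot x u *: u + dot x v *: v.
Proof.
move: u1 v1 uv0; rewrite !dotE => h1 h2 h3.
(* [d] is the determinant of the frame. Orthonormality forces [v = d *: rot90 u] with [d ^+ 2 = 1],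
   after which both coordinates are polynomial identities modulo these relations. *)
pose d := u 0 0 * v 0 1 - u 0 1 * v 0 0.
have e0 : v 0 0 = - d * u 0 1.
  have := congr1 ( *%R (v 0 0)) h1; have := congr1 ( *%R (u 0 0)) h3.
  rewrite /d; lra.
have e1 : v 0 1 = d * u 0 0.
  have := congr1 ( *%R (v 0 1)) h1; have := congr1 ( *%R (u 0 1)) h3.
  rewrite /d; lra.
have d1 : d ^+ 2 = 1.
  move: h2; rewrite e0 e1 => <-; rewrite -[LHS]mulr1 -h1; ring.
have d11 : d * d = 1 by [].
apply: rV2P; rewrite !mxE e0 e1 -[LHS]mulr1 -h1; apply/eqP;
  rewrite -subr_eq0; apply/eqP.
- transitivity ((1 - d * d) * u 0 1 * (x 0 0 * u 0 1 - x 0 1 * u 0 0)).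
    ring.
  by rewrite d11 subrr !mul0r.
- transitivity ((1 - d * d) * u 0 0 * (x 0 1 * u 0 0 - x 0 0 * u 0 1)).
    ring.
  by rewrite d11 subrr !mul0r.
Qed.

Lemma frame_dot x y : dot x y = dot x u * dot y u + dot x v * dot y v.
Proof. by rewrite {1}(frameE x) !dotlin !(dotC _ y). Qed.

Lemma frame_eq x y : dot x u = dot y u -> dot x v = dot y v -> x = y.
Proof. by move=> e1 e2; rewrite (frameE x) e1 e2 -frameE. Qed.

End Frame.
End Euclidean_plane.

(** * Convex hulls and extreme points *)

Section Convexity.
Context {R : realType}.
Implicit Types (x y z u v : 'rV[R]_2) (a b t : R) (A B C E : set 'rV[R]_2).

Lemma convex_setP C : convex_set C <->
  forall x y t, C x -> C y -> 0 <= t -> t <= 1 -> C (t *: x + (1 - t) *: y).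
Proof.
split=> [h x y t Cx Cy t0 t1|h x y l /set_mem Cx /set_mem Cy].
- have := h x y (Itv01 t0 t1) (mem_set Cx) (mem_set Cy).
  by move/set_mem; rewrite /conv /=.
- by apply/mem_set; apply: h.
Qed.

Lemma hull_convex E x y t : convex_hull E x -> convex_hull E y ->
  0 <= t -> t <= 1 -> convex_hull E (t *: x + (1 - t) *: y).
Proof.
move=> hx hy t0 t1 C [cC EC]; move/convex_setP: (cC); apply=> //.
- exact: (hx _ (conj cC EC)).
- exact: (hy _ (conj cC EC)).
Qed.

Lemma sub_hull E : E `<=` convex_hull E.
Proof. exact: sub_gen_smallest. Qed.

Lemma hull_min E C :
  (forall x y t, C x -> C y -> 0 <= t -> t <= 1 -> C (t *: x + (1 - t) *: y)) ->
  E `<=` C -> convex_hull E `<=` C.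
Proof. by move=> /convex_setP cC EC; apply: smallest_sub. Qed.

Section Linear.
Variable f : 'rV[R]_2 -> 'rV[R]_2.
Hypothesis lf : linear f.

Lemma lin0 : f 0 = 0.
Proof.
have := lf 1 0 0; rewrite scaler0 addr0 scale1r.
by move/(congr1 (fun z => z - f 0)); rewrite subrr addrK.
Qed.

Lemma linZ a x : f (a *: x) = a *: f x.
Proof. by have := lf a x 0; rewrite lin0 !addr0. Qed.

Lemma linN x : f (- x) = - f x.
Proof. by rewrite -scaleN1r linZ scaleN1r. Qed.

Lemma linD x y : f (x + y) = f x + f y.
Proof. by have := lf 1 x y; rewrite !scale1r. Qed.

Lemma lin_comb a b x y : a *: f x + b *: f y = f (a *: x + b *: y).
Proof. by rewrite linD !linZ. Qed.

End Linear.

Lemma image_hull (f : 'rV[R]_2 -> 'rV[R]_2) E : linear f ->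
  f @` convex_hull E = convex_hull (f @` E).
Proof.
move=> lf.
have fZ a x y := lin_comb lf a (1 - a) x y.
rewrite eqEsubset; split.
- move=> _ [x hx <-].
  suff : convex_hull E `<=` f @^-1` convex_hull (f @` E) by apply.
  apply: hull_min => [y z t hy hz t0 t1|y Ey]; rewrite /preimage /=.
    by rewrite -fZ; apply: hull_convex.
  by apply: sub_hull; exists y.
- apply: hull_min => [_ _ t [y hy <-] [z hz <-] t0 t1|_ [y Ey <-]].
    by exists (t *: y + (1 - t) *: z); [apply: hull_convex | rewrite -fZ].
  by exists y => //; apply: sub_hull.
Qed.

Lemma hull_dot_le E n M : (forall e, E e -> dot e n <= M) ->
  forall x, convex_hull E x -> dot x n <= M.
Proof.
move=> h x; move: x; apply: hull_min => // x y t hx hy t0 t1.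
by rewrite !dotlin; nra.
Qed.

Lemma finite_argmax E (F : 'rV[R]_2 -> R) : finite_set E -> E !=set0 ->
  exists2 e, E e & forall x, E x -> F x <= F e.
Proof.
move=> /finite_seqP[s ->] [z0 /= z0s].
elim: s z0 z0s => [//|y s IH] z0 _.
have [|s0] := boolP (s == [::]).
  move=> /eqP->; exists y => /=; first by rewrite inE eqxx.
  by move=> x /=; rewrite inE => /eqP ->.
have [z zs] : exists z, z \in s.
  by case: (s) s0 => // z s' _; exists z; rewrite inE eqxx.
have [e es he] := IH z zs.
have [hy|hy] := leP (F y) (F e).
- exists e => /=; first by rewrite inE es orbT.
  by move=> x /=; rewrite inE => /predU1P[->//|]; apply: he.
- exists y => /=; first by rewrite inE eqxx.
  move=> x /=; rewrite inE => /predU1P[->//|/he].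
  by move=> /le_trans; apply; apply: ltW.
Qed.

Lemma hull_dot_attained E n x : finite_set E -> E !=set0 -> convex_hull E x ->
  exists2 e, E e & dot x n <= dot e n.
Proof.
move=> fE E0 hx; have [e Ee he] := finite_argmax (fun z => dot z n) fE E0.
by exists e => //; apply: hull_dot_le hx.
Qed.

Lemma o_symmetricN H x : o_symmetric H -> H x -> H (- x).
Proof. by move=> hs Hx; rewrite /o_symmetric in hs; rewrite hs; exists x. Qed.

Lemma extremeN H x : o_symmetric H -> extreme_points H x ->
  extreme_points H (- x).
Proof.
move=> hs [Hx ex]; split; first exact: o_symmetricN.
move=> y z t Hy Hz t01 e.
have [|h1 h2] := ex (- y) (- z) t (o_symmetricN hs Hy) (o_symmetricN hs Hz) t01.
  by rewrite !scalerN -opprD -e opprK.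
by split; [rewrite -h1 | rewrite -h2]; rewrite opprK.
Qed.

Lemma extreme_image H (f : 'rV[R]_2 -> 'rV[R]_2) x : linear f -> injective f ->
  f @` H = H -> extreme_points H x -> extreme_points H (f x).
Proof.
move=> lf fi fH [Hx ex]; split; first by rewrite -fH; exists x.
have fZ a y z := lin_comb lf a (1 - a) y z.
move=> y z t; rewrite -{1 2}fH => -[y' Hy <-] [z' Hz <-] t01.
by rewrite fZ => /fi /(ex _ _ _ Hy Hz t01) [-> ->].
Qed.

End Convexity.

(** * Vertices of o-symmetric polygons *)

Section Symmetric_polygons.
Context {R : realType}.
Implicit Types (p q r x y z u v : 'rV[R]_2) (a b t : R) (H E : set 'rV[R]_2).

(** Vertices of an o-symmetric polygon come in opposite pairs; up to [eqpm] a hexagon has three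
    vertices and a parallelogram two. *)
Definition eqpm x p := x = p \/ x = - p.

(** A sign written as a scalar of square 1 passes through linear maps and multiplies, which saves
    case distinctions. *)
Lemma eqpmP x p : eqpm x p <-> exists2 s : R, s * s = 1 & x = s *: p.
Proof.
split=> [[->|->]|[s s1 ->]].
- by exists 1; rewrite ?mulr1 ?scale1r.
- by exists (-1); rewrite ?mulrN1 ?opprK ?scaleN1r.
- have /eqP : (s - 1) * (s + 1) = 0 by rewrite mulrDr !mulrBl s1; ring.
  rewrite mulf_eq0 subr_eq0 addr_eq0 => /orP[] /eqP ->.
    by left; rewrite scale1r.
  by right; rewrite scaleN1r.
Qed.

Lemma eqpmC x p : eqpm x p -> eqpm p x.
Proof. by case=> ->; [left|right; rewrite opprK]. Qed.

Lemma eqpm_trans x y z : eqpm x y -> eqpm y z -> eqpm x z.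
Proof. by case=> -> [] ->; rewrite ?opprK; [left|right|right|left]. Qed.

Lemma finite_card_seq (T : choiceType) (A : set T) n : (A #= `I_n)%card ->
  exists2 s : seq T, uniq s & size s = n /\ A = [set` s].
Proof.
move=> An; have /finite_seqP[s As] : finite_set A by apply/finite_setP; exists n.
exists (undup s); first exact: undup_uniq.
have Au : A = [set` undup s].
  by rewrite As; apply/seteqP; split=> x /=; rewrite mem_undup.
(* The enumeration by [nth] below needs a default element, so the empty set is treated apart. *)
split=> //; case: n An => [|n] An.
  move: An; rewrite II0 card_eq0 => /eqP A0.
  case us: (undup s) => [//|w s']; suff : A w by rewrite A0.
  by rewrite Au /= us inE eqxx.
apply/card_eq_II; apply: (card_eq_trans _ An); rewrite Au.
have [w ws] : exists w, w \in undup s.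
  case us: (undup s) => [|w s']; last by exists w; rewrite inE eqxx.
  move: An; rewrite Au us set_nil card_eq_sym card_eq0 => /eqP /seteqP[].
  by move=> /(_ 0%N isT).
have -> : [set` undup s] = nth w (undup s) @` `I_(size (undup s)).
  apply/seteqP; split=> [x /= xs|_ [i /= iu <-]]; last exact: mem_nth.
  by exists (index x (undup s)); rewrite /= ?index_mem ?nth_index.
apply: card_esym; apply: inj_card_eq => i j /set_mem /= iu /set_mem /= ju /eqP.
by rewrite nth_uniq ?undup_uniq// => /eqP.
Qed.

(** Splits off one opposite pair: since 0 is absent, [- p] differs from [p] and sits in the tail,
    and removing it leaves a symmetric list. Iteration names one vertex from each pair. *)
Lemma sym_seq_rec (s : seq 'rV[R]_2) n : uniq s -> size s = n.+2 ->
  (forall x, x \in s -> - x \in s) -> 0 \notin s ->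
  exists p s', [/\ uniq s', size s' = n, forall x, x \in s' -> - x \in s',
    0 \notin s' & forall x, x \in s <-> eqpm x p \/ x \in s'] /\
    p \notin s' /\ p != 0.
Proof.
case: s => // p s us [ss] Ns s0.
have p0 : p != 0 by apply: contra s0 => /eqP->; rewrite inE eqxx.
have Np : - p != p.
  apply: contra p0 => /eqP h; rewrite -dot_eq0.
  by have := dotNl p p; rewrite h => /eqP; rewrite -addr_eq0 -mulr2n mulrn_eq0.
have Nps : - p \in s.
  by have := Ns p; rewrite !inE eqxx (negPf Np) /=; apply.
move: us => /= /andP[ps us].
exists p, (rem (- p) s); split; last first.
  by rewrite mem_rem_uniq// !inE negb_and ps orbT.
split.
- exact: rem_uniq.
- by rewrite size_rem// ss.
- move=> x; rewrite !mem_rem_uniq// !inE => /andP[xp xs].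
  rewrite eqr_opp; have := Ns x; rewrite !inE xs orbT => /(_ isT).
  rewrite eqr_oppLR (negPf xp) /= => ->; rewrite andbT.
  by apply: contraNneq ps => <-.
- by apply: contra s0 => /mem_rem h; rewrite inE h orbT.
- move=> x; rewrite mem_rem_uniq// !inE; split.
    move=> /predU1P[->|xs]; first by left; left.
    by case: (eqVneq x (- p)) => [->|]; [left; right | right].
  by case=> [[->|->]|/andP[_ ->]]; rewrite ?eqxx// ?Nps orbT.
Qed.

Lemma sym_set4 E : (E #= `I_4)%card -> (forall x, E x -> E (- x)) -> ~ E 0 ->
  exists p q, [/\ p != 0, q != 0, ~ eqpm q p &
    forall x, E x <-> eqpm x p \/ eqpm x q].
Proof.
move=> /finite_card_seq[s us [ss Es]] NE E0.
have [p [s1 [[us1 ss1 Ns1 s10 hp] [ps1 p0]]]] : exists p s',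
  [/\ uniq s', size s' = 2, forall x, x \in s' -> - x \in s',
    0 \notin s' & forall x, x \in s <-> eqpm x p \/ x \in s'] /\
    p \notin s' /\ p != 0.
  by apply: sym_seq_rec => //; [move=> x; move: (NE x); rewrite Es|
     apply/negP; rewrite Es in E0].
have [q [s2 [[us2 /size0nil s20 Ns2 _ hq] [_ q0]]]] :=
  sym_seq_rec us1 ss1 Ns1 s10.
exists p, q; split=> //.
- move=> /eqpmC qp; have : p \in s1 by apply/hq; left.
  by rewrite (negPf ps1).
- move=> x; rewrite Es /=; split=> [/hp[]|].
  + by left.
  + by move=> /hq[]; [right | rewrite s20].
  + by case=> h; apply/hp; [left | right; apply/hq; left].
Qed.

Lemma sym_set6 E : (E #= `I_6)%card -> (forall x, E x -> E (- x)) -> ~ E 0 ->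
  exists p q r, [/\ p != 0, q != 0, r != 0 &
    [/\ ~ eqpm q p, ~ eqpm r p, ~ eqpm r q &
    forall x, E x <-> [\/ eqpm x p, eqpm x q | eqpm x r]]].
Proof.
move=> /finite_card_seq[s us [ss Es]] NE E0.
have [p [s1 [[us1 ss1 Ns1 s10 hp] [ps1 p0]]]] : exists p s',
  [/\ uniq s', size s' = 4, forall x, x \in s' -> - x \in s',
    0 \notin s' & forall x, x \in s <-> eqpm x p \/ x \in s'] /\
    p \notin s' /\ p != 0.
  by apply: sym_seq_rec => //; [move=> x; move: (NE x); rewrite Es|
     apply/negP; rewrite Es in E0].
have [q [s2 [[us2 ss2 Ns2 s20 hq] [qs2 q0]]]] := sym_seq_rec us1 ss1 Ns1 s10.
have [r [s3 [[us3 /size0nil s30 Ns3 _ hr] [_ r0]]]] :=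
  sym_seq_rec us2 ss2 Ns2 s20.
exists p, q, r; split=> //; split.
- move=> /eqpmC qp; have : p \in s1 by apply/hq; left.
  by rewrite (negPf ps1).
- move=> /eqpmC rp; have : p \in s1 by apply/hq; right; apply/hr; left.
  by rewrite (negPf ps1).
- move=> /eqpmC rq; have : q \in s2 by apply/hr; left.
  by rewrite (negPf qs2).
- move=> x; rewrite Es /=; split=> [/hp[]|].
  + by constructor 1.
  + move=> /hq[]; first by constructor 2.
    by move=> /hr[]; [constructor 3 | rewrite s30].
  + case=> h; apply/hp; first by left.
      by right; apply/hq; left.
    by right; apply/hq; right; apply/hr; left.
Qed.

(** The determinant of the pair, written with the quarter turn so that linearity comes from
    [dot]. *)
Definition det2 p q := dot (rot90 p) q.

Lemma det2E p q : det2 p q = p 0 0 * q 0 1 - p 0 1 * q 0 0.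
Proof. by rewrite /det2 dotE !mxE /=; ring. Qed.

Lemma det2C p q : det2 p q = - det2 q p.
Proof. by rewrite !det2E; ring. Qed.
Lemma det2xx p : det2 p p = 0.
Proof. by rewrite !det2E; ring. Qed.
Lemma det2Dr p x y : det2 p (x + y) = det2 p x + det2 p y.
Proof. by rewrite /det2 dotDr. Qed.
Lemma det2Zr p a y : det2 p (a *: y) = a * det2 p y.
Proof. by rewrite /det2 dotZr. Qed.

Lemma det2_eq0 p q : p != 0 -> det2 p q = 0 ->
  q = (dot p q / dot p p) *: p.
Proof.
move=> /dot_gt0 p0; rewrite det2E => h.
have e : dot p p *: q = dot p q *: p.
  apply: rV2P; rewrite !dotE !mxE; apply/eqP; rewrite -subr_eq0; apply/eqP.
    transitivity (- p 0 1 * (p 0 0 * q 0 1 - p 0 1 * q 0 0)); first by ring.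
    by rewrite h mulr0.
  transitivity (p 0 0 * (p 0 0 * q 0 1 - p 0 1 * q 0 0)); first by ring.
  by rewrite h mulr0.
by rewrite mulrC -scalerA -e scalerK// gt_eqF.
Qed.

(** Cramer's rule. *)
Lemma det2_basis p q x : det2 p q != 0 ->
  x = (det2 x q / det2 p q) *: p + (det2 p x / det2 p q) *: q.
Proof.
move=> h; apply: (scalerI h).
rewrite scalerDr !scalerA !(mulrC (det2 p q)) !divfK//.
by apply: rV2P; rewrite !det2E !mxE; ring.
Qed.

Lemma det2_orthogonal_eq0 p q n : det2 p q != 0 -> dot p n = 0 ->
  dot q n = 0 -> n = 0.
Proof.
move=> h pn qn; apply/eqP; rewrite -dot_eq0 [in X in dot X _](det2_basis n h).
by rewrite !dotlin pn qn !mulr0 addr0.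
Qed.

(** Of two parallel vertices, the shorter lies on the segment from the longer one to its opposite;
    it is extreme only as an end of that segment. *)
Lemma extreme_det2 H p q : o_symmetric H -> extreme_points H p ->
  extreme_points H q -> p != 0 -> q != 0 -> ~ eqpm q p -> det2 p q != 0.
Proof.
move=> hs; wlog : p q / dot q q <= dot p p.
  move=> hw ep eq p0 q0 qp; have [h|/ltW h] := leP (dot q q) (dot p p).
    exact: hw.
  by rewrite det2C oppr_eq0; apply: hw => // /eqpmC.
move=> qp [Hp _] [Hq eq] p0 q0 neq; apply/eqP => /(det2_eq0 p0).
set t := _ / _ => qE.
have tt : t * t <= 1.
  have := dot_gt0 p0; move: qp; rewrite qE !dotlin => *; nra.
have [t1|t1] := eqVneq (t * t) 1.
  by apply: neq; apply/eqpmP; exists t.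
have {}t1 : t * t < 1 by rewrite lt_neqAle t1.
have t01 : 0 < (1 + t) / 2 < 1 by apply/andP; split; nra.
have [] := eq p (- p) ((1 + t) / 2) Hp (o_symmetricN hs Hp) t01.
  rewrite qE scalerN -scaleNr -scalerDl; congr (_ *: _); lra.
by move=> pq _; apply: neq; left.
Qed.

(** If [|a| + |b| <= 1], then [r] is the combination, with weight [|a|], of [Num.sg a *: p] and a
    multiple of [q] lying between [- q] and [q]. Extremeness would make [r] parallel to [p], against
    [b != 0]. *)
Lemma extreme_coord_gt1 H p q r a b : o_symmetric H ->
  H = convex_hull (extreme_points H) -> H p -> H q -> extreme_points H r ->
  det2 p q != 0 -> r = a *: p + b *: q -> a != 0 -> b != 0 ->
  1 < `|a| + `|b|.
Proof.
move=> hs hull Hp Hq [Hr er] cpq rE a0 b0; rewrite ltNge; apply/negP => ab.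
have {}a0 : 0 < `|a| by rewrite normr_gt0.
have b0' : 0 < `|b| by rewrite normr_gt0.
have a1 : 0 < 1 - `|a| by lra.
have cH x y t : H x -> H y -> 0 <= t -> t <= 1 -> H (t *: x + (1 - t) *: y).
  by rewrite hull; exact: hull_convex.
have sym t x : H x -> `|t| <= 1 -> H (t *: x).
  move=> Hx; rewrite ler_norml => /andP[t1 t2].
  have -> : t *: x = ((1 + t) / 2) *: x + (1 - (1 + t) / 2) *: (- x).
    by rewrite scalerN -scaleNr -scalerDl; congr (_ *: _); lra.
  by apply: cH => //; [exact: o_symmetricN | lra | lra].
have Hz : H ((b / (1 - `|a|)) *: q).
  apply: sym => //; rewrite normrM normfV (gtr0_norm a1) ler_pdivrMr//; lra.
have Hy : H (Num.sg a *: p).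
  by apply: sym => //; rewrite normr_sg; case: (a == 0).
have [||] := er _ _ `|a| Hy Hz.
- by apply/andP; split=> //; lra.
- rewrite !scalerA [`|a| * _]mulrC -numEsg [(1 - `|a|) * _]mulrC.
  by rewrite divfK ?gt_eqF.
- move=> pr _; have /eqP := congr1 (det2 p) pr.
  rewrite rE det2Dr !det2Zr det2xx !mulr0 add0r eq_sym mulf_eq0.
  by rewrite (negPf cpq) orbF -normr_eq0 gt_eqF.
Qed.
End Symmetric_polygons.

(** * Circumscribed rectangles *)

Section Rectangles.
Context {R : realType}.
Implicit Types (p q r x y z u v : 'rV[R]_2) (a b t : R) (H E : set 'rV[R]_2).
Implicit Types Q : rectangle R.

(** Once [g 0] is subtracted, polarization turns scaled distances into scaled inner products; the
    defect of linearity then has norm zero. *)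
Lemma similarity_linear (g : 'rV[R]_2 -> 'rV[R]_2) : similarity g ->
  exists L c, [/\ 0 < c, linear L, forall x, g x = g 0 + L x &
    forall x y, dot (L x) (L y) = c ^+ 2 * dot x y].
Proof.
move=> [c c0 hg].
have [L LE] : exists L, forall x, L x = g x - g 0 by exists (fun x => g x - g 0).
have dL x y : dot (L x - L y) (L x - L y) = c ^+ 2 * dot (x - y) (x - y).
  by rewrite -!enorm_sqr -exprMn -hg !LE opprB addrA subrK.
have L0 : L 0 = 0 by rewrite LE subrr.
have LL x : dot (L x) (L x) = c ^+ 2 * dot x x.
  by have := dL x 0; rewrite L0 !subr0.
have Ld x y : dot (L x) (L y) = c ^+ 2 * dot x y.
  have := dL x y; have := LL x; have := LL y.
  rewrite !dotlin (dotC (L y) (L x)) (dotC y x); lra.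
exists L, c; split=> //; last by move=> x; rewrite LE addrC subrK.
move=> a x y; apply/eqP; rewrite -subr_eq0 -dot_eq0 !dotlin !Ld !dotlin.
rewrite (dotC y x); apply/eqP; ring.
Qed.

Section Frame_of_rectangle.
Variable Q : rectangle R.

Lemma short_dir1 : dot (short_dir Q) (short_dir Q) = 1.
Proof. exact/enorm1P/short_dir_unit. Qed.

Lemma long_dir1 : dot (long_dir Q) (long_dir Q) = 1.
Proof. exact/enorm1P/long_dir_unit. Qed.

Lemma long_len_gt0 : 0 < long_len Q.
Proof. exact: lt_le_trans (short_len_gt0 Q) (short_le_long Q). Qed.

Lemma aspect_gt0 : 0 < aspect_ratio Q.
Proof. by rewrite divr_gt0 ?long_len_gt0 ?short_len_gt0. Qed.

Lemma aspect_le1 : aspect_ratio Q <= 1.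
Proof. by rewrite ler_pdivrMr ?long_len_gt0// mul1r short_le_long. Qed.

Lemma rect_set_dot x : rect_set Q x ->
  let p := corner Q in
  (dot p (short_dir Q) <= dot x (short_dir Q)
     <= dot p (short_dir Q) + short_len Q) /\
  (dot p (long_dir Q) <= dot x (long_dir Q)
     <= dot p (long_dir Q) + long_len Q).
Proof.
move=> [s + [t + <-]] p; rewrite /= !in_itv /= => /andP[s0 s1] /andP[t0 t1].
rewrite !dotlin short_dir1 long_dir1 [dot (long_dir Q) (short_dir Q)]dotC.
by rewrite dir_orthogonal; split; apply/andP; split; lra.
Qed.

End Frame_of_rectangle.

(** Every side carries a point of [H]. Reflecting these points in o shows that the rectangle is
    centred at o, hence the halves of the side lengths. *)
Lemma circumscribed_bounds H Q : o_symmetric H -> circumscribed H Q ->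
  [/\ forall x, H x -> dot x (long_dir Q) <= long_len Q / 2,
      forall x, H x -> dot x (short_dir Q) <= short_len Q / 2,
      exists2 x, H x & dot x (long_dir Q) = long_len Q / 2 &
      exists2 x, H x & dot x (short_dir Q) = short_len Q / 2].
Proof.
move=> hs [HQ hQ].
have ortho : dot (long_dir Q) (short_dir Q) = 0 by rewrite dotC dir_orthogonal.
have bnd x (Hx : H x) := rect_set_dot (HQ x Hx).
have := hQ (segment (corner Q) (corner Q + short_len Q *: short_dir Q)).
case; first by left; left; left.
move=> x1 [Hx1 [t1 _ x1E]].
have := hQ (segment (corner Q + long_len Q *: long_dir Q)
  (corner Q + short_len Q *: short_dir Q + long_len Q *: long_dir Q)).
case; first by left; left; right.
move=> x2 [Hx2 [t2 _ x2E]].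
have := hQ (segment (corner Q) (corner Q + long_len Q *: long_dir Q)).
case; first by left; right.
move=> x3 [Hx3 [t3 _ x3E]].
have := hQ (segment (corner Q + short_len Q *: short_dir Q)
  (corner Q + short_len Q *: short_dir Q + long_len Q *: long_dir Q)).
case; first by right.
move=> x4 [Hx4 [t4 _ x4E]].
have e1 : dot x1 (long_dir Q) = dot (corner Q) (long_dir Q).
  by rewrite -x1E !dotlin dir_orthogonal; ring.
have e2 : dot x2 (long_dir Q) = dot (corner Q) (long_dir Q) + long_len Q.
  by rewrite -x2E !dotlin dir_orthogonal long_dir1; ring.
have e3 : dot x3 (short_dir Q) = dot (corner Q) (short_dir Q).
  by rewrite -x3E !dotlin ortho; ring.
have e4 : dot x4 (short_dir Q) = dot (corner Q) (short_dir Q) + short_len Q.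
  by rewrite -x4E !dotlin ortho short_dir1; ring.
have [_ /andP[]] := bnd _ (o_symmetricN hs Hx1).
have [_ /andP[]] := bnd _ (o_symmetricN hs Hx2).
have [/andP[+ +] _] := bnd _ (o_symmetricN hs Hx3).
have [/andP[+ +] _] := bnd _ (o_symmetricN hs Hx4).
rewrite !dotNl => *; split.
- by move=> x Hx; have [_ /andP[]] := bnd _ Hx; lra.
- by move=> x Hx; have [/andP[+ +] _] := bnd _ Hx; lra.
- by exists x2 => //; lra.
- by exists x4 => //; lra.
Qed.

(** Converse of [circumscribed_bounds]: attained bounds in two orthogonal directions give a
    rectangle centred at o, whose sides are touched at [x], [y] and their opposites. *)
Lemma circumscribed_exists H u v X Y x y : o_symmetric H ->
  dot u u = 1 -> dot v v = 1 -> dot u v = 0 -> 0 < Y -> Y <= X ->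
  (forall z, H z -> dot z u <= Y) -> (forall z, H z -> dot z v <= X) ->
  H x -> dot x v = X -> H y -> dot y u = Y ->
  exists2 Q, circumscribed H Q & aspect_ratio Q = Y / X.
Proof.
move=> hs u1 v1 uv Y0 YX hu hv Hx xX Hy yY.
have u1' : enorm u = 1 by apply/enorm1P.
have v1' : enorm v = 1 by apply/enorm1P.
have Y2 : 0 < 2 * Y by lra.
have YX2 : 2 * Y <= 2 * X by lra.
have X0 : 0 < X by lra.
pose Q := Rectangle (- Y *: u - X *: v) u1' v1' uv Y2 YX2.
exists Q; last by rewrite /aspect_ratio /= -mulf_div divff ?mul1r.
have hu' z : H z -> - Y <= dot z u.
  by move=> Hz; have := hu _ (o_symmetricN hs Hz); rewrite dotNl; lra.
have hv' z : H z -> - X <= dot z v.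
  by move=> Hz; have := hv _ (o_symmetricN hs Hz); rewrite dotNl; lra.
have vu : dot v u = 0 by rewrite dotC.
split=> [z Hz|S].
  exists (dot z u + Y) => /=.
    by rewrite in_itv /=; apply/andP; split; have := hu _ Hz; have := hu' _ Hz; lra.
  exists (dot z v + X) => /=.
    by rewrite in_itv /=; apply/andP; split; have := hv _ Hz; have := hv' _ Hz; lra.
  by apply: (frame_eq u1 v1 uv); rewrite !dotlin ?u1 ?v1 ?uv ?vu; ring.
have tX z : H z -> (dot z v + X) / (2 * X) \in `[0, 1].
  move=> Hz; rewrite in_itv /=; apply/andP; split.
    by rewrite divr_ge0//; have := hv' _ Hz; lra.
  by rewrite ler_pdivrMr; have := hv _ Hz; lra.
have tY z : H z -> (dot z u + Y) / (2 * Y) \in `[0, 1].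
  move=> Hz; rewrite in_itv /=; apply/andP; split.
    by rewrite divr_ge0//; have := hu' _ Hz; lra.
  by rewrite ler_pdivrMr; have := hu _ Hz; lra.
have HNx := o_symmetricN hs Hx; have HNy := o_symmetricN hs Hy.
have X0' : X != 0 by rewrite gt_eqF.
have Y0' : Y != 0 by rewrite gt_eqF.
case=> [[[|]|]|] -> /=.
- exists (- x); split=> //; exists ((dot (- x) u + Y) / (2 * Y)) => /=.
    exact: tY.
  by apply: (frame_eq u1 v1 uv); rewrite !dotlin ?u1 ?v1 ?uv ?vu ?xX; field.
- exists x; split=> //; exists ((dot x u + Y) / (2 * Y)) => /=.
    exact: tY.
  by apply: (frame_eq u1 v1 uv); rewrite !dotlin ?u1 ?v1 ?uv ?vu ?xX; field.
- exists (- y); split=> //; exists ((dot (- y) v + X) / (2 * X)) => /=.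
    exact: tX.
  by apply: (frame_eq u1 v1 uv); rewrite !dotlin ?u1 ?v1 ?uv ?vu ?yY; field.
- exists y; split=> //; exists ((dot y v + X) / (2 * X)) => /=.
    exact: tX.
  by apply: (frame_eq u1 v1 uv); rewrite !dotlin ?u1 ?v1 ?uv ?vu ?yY; field.
Qed.

Lemma extremal_aspect_le H Q Q' : extremal_rectangle H Q ->
  circumscribed H Q' -> aspect_ratio Q <= aspect_ratio Q'.
Proof.
move=> [_ ->] hQ'; apply: ge_inf; last by exists Q'.
by exists 0 => _ [Q'' _ <-]; exact: ltW (aspect_gt0 Q'').
Qed.

(* The extremality of [Q] in terms of the support function h of H:
   k h(n) <= h(n') for n' the vector n turned by a right angle. *)
Lemma extremal_support H E Q p q n x : o_symmetric H -> H = convex_hull E ->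
  finite_set E -> H p -> H q -> det2 p q != 0 -> extremal_rectangle H Q ->
  H x -> exists2 e, E e & aspect_ratio Q * dot x n <= dot e (rot90 n).
Proof.
move=> hs HE fE Hp Hq pq exQ Hx.
have E0 : E !=set0.
  apply: contrapT => /set0P/negP/negPn/eqP E0.
  suff : (convex_hull E `<=` (set0 : set 'rV[R]_2)) by apply; rewrite -HE; exact: Hx.
  by apply: hull_min => // y; rewrite E0.
have EH e : E e -> H e by rewrite HE; apply: sub_hull.
(* The support function is positive in nonzero directions, because [H] is symmetric and contains the
   basis [p], [q]. *)
have h_gt0 m e : m != 0 -> (forall y, E y -> dot y m <= dot e m) -> 0 < dot e m.
  move=> m0 he; rewrite ltNge; apply: contra m0 => e0; apply/eqP.
  have b z : H z -> dot z m <= 0.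
    by rewrite HE; apply: hull_dot_le => y /he /le_trans; apply.
  have b0 z : H z -> dot z m = 0.
    by move=> Hz; have := b _ Hz; have := b _ (o_symmetricN hs Hz);
      rewrite dotNl; lra.
  by apply: (det2_orthogonal_eq0 pq); apply: b0.
have [->|n0] := eqVneq n 0.
  case: E0 => e Ee; exists e => //.
  by rewrite -{1}(scale0r x) dotZr mul0r mulr0 -(scale0r x) rot90Z dotZr mul0r.
have rn0 : rot90 n != 0 by rewrite -dot_eq0 dot_rot90_rot90 dot_eq0.
have [e Ee he] := finite_argmax (fun y => dot y n) fE E0.
have [f Ef hf] := finite_argmax (fun y => dot y (rot90 n)) fE E0.
have e_gt0 := h_gt0 _ _ n0 he; have f_gt0 := h_gt0 _ _ rn0 hf.
have k0 := aspect_gt0 Q; have k1 := aspect_le1 Q.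
exists f => //; apply: (@le_trans _ _ (aspect_ratio Q * dot e n)).
  rewrite ler_pM2l//; move: Hx; rewrite HE; exact: hull_dot_le.
(* If h(n) < h(n'), then k <= 1 suffices. Otherwise the rectangle with directions n' and n has ratio
   h(n') / h(n), which is at least k by extremality. *)
have [fe|/ltW ef] := leP (dot f (rot90 n)) (dot e n); last by nra.
have N0 : 0 < enorm n by rewrite enorm_gt0.
have NN : enorm n * enorm n = dot n n by rewrite -expr2 enorm_sqr.
have iN : 0 < (enorm n)^-1 by rewrite invr_gt0.
have nn : (enorm n)^-1 * ((enorm n)^-1 * dot n n) = 1.
  by rewrite -NN; field; rewrite gt_eqF.
have [|||||||||||Q' cQ' aQ'] := @circumscribed_exists H ((enorm n)^-1 *: rot90 n)
  ((enorm n)^-1 *: n) ((enorm n)^-1 * dot e n)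
  ((enorm n)^-1 * dot f (rot90 n)) e f hs.
- by rewrite !dotlin dot_rot90_rot90.
- by rewrite !dotlin.
- by rewrite !dotlin dotC dot_rot90r !mulr0.
- by rewrite mulr_gt0.
- by rewrite ler_pM2l.
- by move=> z Hz; rewrite dotZr ler_pM2l//; move: Hz; rewrite HE; apply: hull_dot_le.
- by move=> z Hz; rewrite dotZr ler_pM2l//; move: Hz; rewrite HE; apply: hull_dot_le.
- exact: EH.
- by rewrite dotZr.
- exact: EH.
- by rewrite dotZr.
have := extremal_aspect_le exQ cQ'; rewrite aQ' -mulf_div divff ?gt_eqF// mul1r.
by rewrite ler_pdivlMr.
Qed.
End Rectangles.

(** * The linear map induced by a similarity *)

Section Invariant_map.
Context {R : realType}.
Implicit Types (p q r x y z u v : 'rV[R]_2) (a b t : R) (H E : set 'rV[R]_2).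
Implicit Types Q : rectangle R.

(* [d] is the determinant of the orthogonal part of the similarity. *)
Definition frame_map Q a b d (A : 'rV[R]_2 -> 'rV[R]_2) :=
  forall x,
  dot (A x) (long_dir Q) = aspect_ratio Q * a * dot x (long_dir Q)
                           - d * b * dot x (short_dir Q) /\
  dot (A x) (short_dir Q) = aspect_ratio Q * b * dot x (long_dir Q)
                           + d * a * dot x (short_dir Q).

Lemma invariant_frame_map H Q : o_symmetric H -> circumscribed H Q ->
  similar_sets (rect_affinity Q @` H) H ->
  exists A a b d, [/\ linear A, A @` H = H, d * d = 1, 0 < a * a + b * b &
    frame_map Q a b d A].
Proof.
move=> hs cHQ [g /similarity_linear[L [c [c0 lL gL dL]]] gH].
have [hv hu [xv Hxv xvE] [xu Hxu xuE]] := circumscribed_bounds hs cHQ.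
have u1 := short_dir1 Q; have v1 := long_dir1 Q.
have uv := dir_orthogonal Q; have vu : dot (long_dir Q) (short_dir Q) = 0.
  by rewrite dotC.
have lf : linear (rect_affinity Q).
  move=> t x y; apply: (frame_eq u1 v1 uv).
    by rewrite /rect_affinity /orthogonal_affinity !dotlin u1; ring.
  by rewrite /rect_affinity /orthogonal_affinity !dotlin uv; ring.
pose A x := L (rect_affinity Q x).
have lA : linear A by move=> t x y; rewrite /A lf lL.
have AH z : H z -> exists2 x, H x & z = g 0 + A x.
  by rewrite -{1}gH => -[_ [x Hx <-] <-]; exists x; rewrite // gL.
have HA x : H x -> H (g 0 + A x).
  by move=> Hx; rewrite -gL -gH; exists (rect_affinity Q x) => //; exists x.
(* Comparing the images of [x] and [- x] shows that [H] is invariant under translation by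
   [2 *: g 0]. At the points touching the rectangle this is possible only for [g 0 = 0]. *)
have trans z : H z -> H (z - 2 *: g 0).
  move=> /AH[x Hx ->]; have := o_symmetricN hs (HA _ (o_symmetricN hs Hx)).
  rewrite (linN lA); congr H; apply: rV2P; rewrite !mxE; ring.
have trans' z : H z -> H (z + 2 *: g 0).
  move=> /(o_symmetricN hs)/trans/(o_symmetricN hs).
  by rewrite opprB opprK addrC.
have g0 : g 0 = 0.
  apply: (frame_eq u1 v1 uv); rewrite dot0l.
    have := hu _ (trans _ Hxu); have := hu _ (trans' _ Hxu).
    by rewrite !dotlin xuE; lra.
  have := hv _ (trans _ Hxv); have := hv _ (trans' _ Hxv).
  by rewrite !dotlin xvE; lra.
pose a := dot (L (long_dir Q)) (long_dir Q).
pose b := dot (L (long_dir Q)) (short_dir Q).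
pose g1 := dot (L (short_dir Q)) (long_dir Q).
pose g2 := dot (L (short_dir Q)) (short_dir Q).
have c2 : 0 < c ^+ 2 by rewrite exprn_gt0.
have ab : a * a + b * b = c ^+ 2.
  by have := dL (long_dir Q) (long_dir Q);
    rewrite v1 mulr1 (frame_dot u1 v1 uv) -/a -/b => <-; ring.
have gg : g1 * g1 + g2 * g2 = c ^+ 2.
  by have := dL (short_dir Q) (short_dir Q);
    rewrite u1 mulr1 (frame_dot u1 v1 uv) -/g1 -/g2 => <-; ring.
have ag : a * g1 + b * g2 = 0.
  have := dL (long_dir Q) (short_dir Q).
  by rewrite vu mulr0 (frame_dot u1 v1 uv) -/a -/b -/g1 -/g2 => <-; ring.
have c20 : c ^+ 2 != 0 by rewrite gt_eqF.
(* The columns ([a], [b]) and ([g1], [g2]) of [L] are orthogonal and both of length [c]; so the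
   second is the first turned by a right angle, times the sign [d]. *)
have [d dE] : exists d, c ^+ 2 * d = a * g2 - b * g1.
  by exists ((a * g2 - b * g1) / c ^+ 2); rewrite mulrC divfK.
have g2E : g2 = d * a.
  apply: (mulfI c20); rewrite mulrA dE -ab.
  apply/eqP; rewrite -subr_eq0; apply/eqP.
  by transitivity (b * (a * g1 + b * g2)); [ring | rewrite ag mulr0].
have g1E : g1 = - (d * b).
  apply: (mulfI c20); rewrite mulrN mulrA dE -ab.
  apply/eqP; rewrite -subr_eq0; apply/eqP.
  by transitivity (a * (a * g1 + b * g2)); [ring | rewrite ag mulr0].
have dd : d * d = 1.
  apply: (mulIf c20); rewrite mul1r -{1}ab -gg g1E g2E; ring.
exists A, a, b, d; split=> //.
- apply/seteqP; split=> [_ [x /HA Hx <-]|x /AH[y Hy ->]].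
    by move: Hx; rewrite g0 add0r.
  by exists y => //; rewrite g0 add0r.
- by rewrite ab.
move=> x; rewrite /A.
have -> : rect_affinity Q x = dot x (short_dir Q) *: short_dir Q
    + (aspect_ratio Q * dot x (long_dir Q)) *: long_dir Q.
  apply: (frame_eq u1 v1 uv); rewrite /rect_affinity /orthogonal_affinity.
    by rewrite !dotlin u1 vu; ring.
  by rewrite !dotlin v1 uv; ring.
rewrite -(lin_comb lL) !dotlin -/a -/b -/g1 -/g2 g1E g2E.
by split; ring.
Qed.

Section Frame_map.
Variables (H : set 'rV[R]_2) (Q : rectangle R) (A : 'rV[R]_2 -> 'rV[R]_2).
Variables (a b d : R).
Hypotheses (lA : linear A) (AH : A @` H = H) (dd : d * d = 1).
Hypotheses (ab : 0 < a * a + b * b) (hA : frame_map Q a b d A).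

Let k := aspect_ratio Q.

(** The determinant of [A] is [d * k * (a * a + b * b)], which does not vanish. *)
Lemma frame_map_inj : injective A.
Proof.
have u1 := short_dir1 Q; have v1 := long_dir1 Q; have uv := dir_orthogonal Q.
move=> x y exy; apply/eqP; rewrite -subr_eq0; apply/eqP.
have : A (x - y) = 0 by rewrite (linD lA) (linN lA) exy subrr.
move: (x - y) => {exy x y}z Az; have [] := hA z; rewrite Az !dot0l.
set X := dot z _; set Y := dot z _ => e1 e2; have k0 : 0 < k := aspect_gt0 Q.
have X0 : k * (a * a + b * b) * X = 0.
  transitivity (a * (k * a * X - d * b * Y) + b * (k * b * X + d * a * Y)).
    by ring.
  by rewrite -e1 -e2 !mulr0 addr0.
have Y0 : (d * d) * (a * a + b * b) * Y = 0.
  transitivity (d * (a * (k * b * X + d * a * Y) - b * (k * a * X - d * b * Y))).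
    by ring.
  by rewrite -e1 -e2 !mulr0 subrr mulr0.
apply: (frame_eq u1 v1 uv); rewrite dot0l; apply/eqP; rewrite -/X -/Y.
  by move/eqP: Y0; rewrite dd mul1r mulf_eq0 gt_eqF.
by move/eqP: X0; rewrite mulf_eq0 gt_eqF// mulr_gt0.
Qed.

Lemma frame_map_Cayley_Hamilton x :
  A (A x) = (a * (k + d)) *: A x - (d * k * (a * a + b * b)) *: x.
Proof.
apply: (frame_eq (short_dir1 Q) (long_dir1 Q) (dir_orthogonal Q)).
  have [_ ->] := hA (A x); rewrite !dotlin; have [-> ->] := hA x.
  by rewrite -/k; ring.
have [-> _] := hA (A x); rewrite !dotlin; have [-> ->] := hA x.
by rewrite -/k; ring.
Qed.

(** An off-diagonal entry of the square of [A] is [a * b * (k * (k + d))], and [k + d != 0] because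
    [k < 1]. For [b = 0] the diagonal entries [k * k * (a * a)] and [a * a] would agree. For [a = 0]
    one gets [k * (b * b) = 1], so [|b| > 1]; but [A] sends a point touching a short side to height
    [b * short_len Q / 2], so [|b| <= 1]. *)
Lemma frame_map_no_involution e : o_symmetric H -> circumscribed H Q ->
  k < 1 -> e * e = 1 -> (forall x, A (A x) = e *: x) -> False.
Proof.
move=> hs cHQ k1 ee AA; have k0 : 0 < k := aspect_gt0 Q.
have [hv hu [xv Hxv xvE] [xu Hxu xuE]] := circumscribed_bounds hs cHQ.
have u1 := short_dir1 Q; have v1 := long_dir1 Q.
have uv := dir_orthogonal Q; have vu : dot (long_dir Q) (short_dir Q) = 0.
  by rewrite dotC.
have [p1 p2] := hA (long_dir Q); have [q1 q2] := hA (A (long_dir Q)).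
have [r1 r2] := hA (short_dir Q); have [s1 s2] := hA (A (short_dir Q)).
move: p1 p2 q1 q2 r1 r2 s1 s2; rewrite !AA !dotlin u1 v1 uv vu -/k.
move=> p1 p2; rewrite p1 p2 => q1 q2 r1 r2; rewrite r1 r2 => s1 s2.
have d1 : k + d != 0.
  apply/eqP => kd; have : d * d < 1 by nra.
  by rewrite dd ltxx.
have : a * b * (k * (k + d)) = 0 by move: q2; lra.
have kd0 : k * (k + d) != 0 by rewrite mulf_neq0// gt_eqF.
move/eqP; rewrite mulf_eq0 (negPf kd0) orbF mulf_eq0 => /orP[]/eqP z0; last first.
  have e1 : e = k * k * (a * a) by move: q1; rewrite z0; lra.
  have e2 : e = (d * d) * (a * a) by move: s2; rewrite z0; lra.
  have kk : 0 < 1 - k * k by nra.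
  have aa : 0 < a * a by move: ab; rewrite z0; lra.
  have := mulr_gt0 kk aa; move: e2; rewrite e1 dd; lra.
have kb : (k * (b * b)) * (k * (b * b)) = 1.
  have e1 : e = - (d * (k * (b * b))) by move: q1; rewrite z0; lra.
  by rewrite -ee e1 mulrNN [RHS]mulrACA dd mul1r.
have kb1 : k * (b * b) = 1 by have : 0 <= k * (b * b); nra.
have HA x : H x -> H (A x) by move=> Hx; rewrite -AH; exists x.
have kXY : k * long_len Q = short_len Q by rewrite /k divfK// gt_eqF// long_len_gt0.
have := hu _ (HA _ Hxv); have := hu _ (HA _ (o_symmetricN hs Hxv)).
have [_ ->] := hA (- xv); have [_ ->] := hA xv.
rewrite !dotNl xvE z0 -/k !(mulr0, mul0r, addr0, oppr0) => h1 h2.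
have L0 := long_len_gt0 Q.
have b1 : b <= 1.
  rewrite -(ler_pM2r (short_len_gt0 Q)) -kXY; lra.
have b2 : - b <= 1.
  rewrite -(ler_pM2r (short_len_gt0 Q)) -kXY; lra.
have : b * b <= 1 by nra.
nra.
Qed.
End Frame_map.
End Invariant_map.

(** * Permutations of the vertices *)

Section Permuted_vertices.
Context {R : realType}.
Implicit Types (p q r x y z u v : 'rV[R]_2) (a b t : R) (H E : set 'rV[R]_2).
Implicit Types Q : rectangle R.

Lemma eqpm_image (A : 'rV[R]_2 -> 'rV[R]_2) x y : linear A ->
  eqpm x y -> eqpm (A x) (A y).
Proof. by move=> lA [->|->]; [left | right; rewrite (linN lA)]. Qed.

Lemma eqpm_image_inj (A : 'rV[R]_2 -> 'rV[R]_2) x y : linear A -> injective A ->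
  eqpm (A x) (A y) -> eqpm x y.
Proof.
by move=> lA iA [/iA->|]; [left | rewrite -(linN lA) => /iA ->; right].
Qed.

(** On the basis [x], [y] the map is, up to signs, the identity or an exchange. Its square is the
    identity in the first case and the product of the two signs in the second. *)
Lemma two_periodic (A : 'rV[R]_2 -> 'rV[R]_2) x y : linear A -> det2 x y != 0 ->
  eqpm (A x) x /\ eqpm (A y) y \/ eqpm (A x) y /\ eqpm (A y) x ->
  exists2 e, e * e = 1 & forall z, A (A z) = e *: z.
Proof.
move=> lA xy h.
have [e ee [ex ey]] : exists2 e, e * e = 1 &
    A (A x) = e *: x /\ A (A y) = e *: y.
  case: h => -[/eqpmP[s ss xE] /eqpmP[t tt yE]].
    exists 1; first by rewrite mulr1.
    by rewrite xE yE !(linZ lA) xE yE !scalerA ss tt.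
  exists (s * t); first by rewrite mulrACA ss tt mulr1.
  by rewrite xE yE !(linZ lA) xE yE !scalerA (mulrC t).
exists e => // z; rewrite (det2_basis z xy) !(linD lA) !(linZ lA) ex ey.
by rewrite scalerDr !scalerA ![e * _]mulrC.
Qed.

Lemma permute_pairs4 E (A : 'rV[R]_2 -> 'rV[R]_2) p q : linear A ->
  injective A -> (forall x, E x -> E (A x)) ->
  (forall x, E x <-> eqpm x p \/ eqpm x q) -> ~ eqpm q p ->
  eqpm (A p) p /\ eqpm (A q) q \/ eqpm (A p) q /\ eqpm (A q) p.
Proof.
move=> lA iA EA hE qp.
have Ep : E p by apply/hE; left; left.
have Eq : E q by apply/hE; right; left.
have npq : ~ eqpm (A q) (A p) by move=> /(eqpm_image_inj lA iA).
have := (hE _).1 (EA _ Ep); have := (hE _).1 (EA _ Eq).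
move=> [h1|h1] [h2|h2]; [|by right|by left|];
  by case: npq; apply: eqpm_trans h1 (eqpmC h2).
Qed.

Lemma permute_pairs6 E (A : 'rV[R]_2 -> 'rV[R]_2) p q r : linear A ->
  injective A -> (forall x, E x -> E (A x)) ->
  (forall x, E x <-> [\/ eqpm x p, eqpm x q | eqpm x r]) ->
  ~ eqpm q p -> ~ eqpm r p -> ~ eqpm r q ->
  det2 p q != 0 -> det2 p r != 0 -> det2 q r != 0 ->
  [\/ exists2 e, e * e = 1 & forall z, A (A z) = e *: z,
      [/\ eqpm (A p) q, eqpm (A q) r & eqpm (A r) p] |
      [/\ eqpm (A p) r, eqpm (A r) q & eqpm (A q) p]].
Proof.
move=> lA iA EA hE qp rp rq dpq dpr dqr.
have Ep : E p by apply/hE; constructor 1; left.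
have Eq : E q by apply/hE; constructor 2; left.
have Er : E r by apply/hE; constructor 3; left.
have nn x y z : ~ eqpm y x -> eqpm (A x) z -> eqpm (A y) z -> False.
  move=> yx h1 h2; apply: yx; apply: (eqpm_image_inj lA iA).
  exact: eqpm_trans h2 (eqpmC h1).
have := (hE _).1 (EA _ Ep); have := (hE _).1 (EA _ Eq).
have := (hE _).1 (EA _ Er).
move=> [h1|h1|h1] [h2|h2|h2] [h3|h3|h3];
  try (by case: (nn _ _ _ qp h3 h2)); try (by case: (nn _ _ _ rp h3 h1));
  try (by case: (nn _ _ _ rq h2 h1));
  try (by constructor 2); try (by constructor 3); constructor 1.
- by apply: (two_periodic lA dpr); right.
- by apply: (two_periodic lA dqr); right.
- by apply: (two_periodic lA dpq); right.
- by apply: (two_periodic lA dpq); left.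
Qed.

(** With trace [t] and determinant [D], Cayley-Hamilton rewrites [A (A (A p)) = e *: p] in the basis
    [p], [A p] as [t * t = D] and [t * D = - e]. Hence [D] has cube 1, so [D = 1] and [t = - e];
    positivity of [D] gives [d = 1]. The map [B] is [A] times the sign [e], which makes the trace
    -1. *)
Lemma three_cycle E Q (A : 'rV[R]_2 -> 'rV[R]_2) a b d p q r : linear A ->
  d * d = 1 -> 0 < a * a + b * b -> frame_map Q a b d A ->
  eqpm (A p) q -> eqpm (A q) r -> eqpm (A r) p -> det2 p q != 0 ->
  (forall x, E x <-> [\/ eqpm x p, eqpm x q | eqpm x r]) ->
  let k := aspect_ratio Q in
  exists B a' b',
  [/\ linear B, frame_map Q a' b' 1 B, a' * (1 + k) = -1,
      k * (a' * a' + b' * b') = 1 &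
      (forall x, B (B x) = - B x - x) /\
      (forall x, E x <-> [\/ eqpm x p, eqpm x (B p) | eqpm x (B (B p))])].
Proof.
move=> lA dd ab hA pq qr rp dpq hE k.
have qAp := eqpmC pq.
have rAAp : eqpm r (A (A p)).
  by apply: eqpm_trans (eqpmC qr) _; apply: eqpm_image.
have /eqpmP[e ee AAAp] : eqpm (A (A (A p))) p.
  apply: eqpm_trans rp; apply: eqpm_image => //; exact: eqpmC.
have [s ss ApE] := (eqpmP _ _).1 pq.
have dpA : det2 p (A p) != 0.
  by rewrite ApE det2Zr mulf_neq0//; apply: contra_eq_neq ss => ->;
    rewrite mul0r eq_sym oner_eq0.
have p0 : p != 0.
  by apply: contraNneq dpA => ->; rewrite det2C /det2 -(scale0r 0) dotZr mul0r oppr0.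
have CH := frame_map_Cayley_Hamilton hA.
have [t tE] : exists t, t = a * (k + d) by eexists.
have [D DE] : exists D, D = d * k * (a * a + b * b) by eexists.
have {}CH x : A (A x) = t *: A x - D *: x by rewrite CH tE DE.
have AAA : (t * t - D) *: A p - (t * D) *: p = e *: p.
  rewrite -AAAp CH [in RHS]CH !scalerBl scalerBr !scalerA.
  by rewrite addrAC.
have tD : t * t = D.
  have := congr1 (det2 p) AAA; rewrite det2Dr -scaleNr.
  rewrite !det2Zr det2xx !mulr0 addr0.
  by move/eqP; rewrite mulf_eq0 (negPf dpA) orbF subr_eq0 => /eqP.
have tDe : t * D = - e.
  move: AAA; rewrite tD subrr scale0r add0r -scaleNr => /eqP.
  rewrite -subr_eq0 -scalerBl scaler_eq0 (negPf p0) orbF subr_eq0 => /eqP <-.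
  by rewrite opprK.
have D2 : D * D * D = 1.
  rewrite -ee -[RHS]mulrNN -tDe -{1}tD; ring.
have D1 : D = 1.
  have /eqP : (D - 1) * (D * D + D + 1) = 0.
    by transitivity (D * D * D - 1); [ring | rewrite D2 subrr].
  rewrite mulf_eq0 subr_eq0 => /orP[/eqP//|/eqP]; nra.
have te : t = - e by rewrite -tDe D1 mulr1.
have d1 : d = 1.
  have k0 : 0 < k := aspect_gt0 Q.
  have : 0 < k * (a * a + b * b) by rewrite mulr_gt0.
  have : d * (k * (a * a + b * b)) = 1 by rewrite mulrA -DE.
  nra.
exists (fun x => e *: A x), (e * a), (e * b).
have lB : linear (fun x => e *: A x).
  by move=> c x y; rewrite lA scalerDr !scalerA (mulrC e).
have BB x : e *: A (e *: A x) = A (A x).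
  by rewrite (linZ lA) scalerA ee scale1r.
split=> //.
- move=> x; rewrite !dotZl; have [-> ->] := hA x.
  by rewrite d1 -/k; split; ring.
- have : a * (k + 1) = - e by rewrite -te tE d1.
  by move=> h; rewrite [1 + k]addrC -mulrA h mulrN ee.
- have -> : e * a * (e * a) + e * b * (e * b) = e * e * (a * a + b * b) by ring.
  by rewrite ee mul1r -D1 DE d1 mul1r.
split=> x; rewrite BB.
  by rewrite CH te D1 scale1r scaleNr.
have eA y : eqpm y (A p) <-> eqpm y (e *: A p).
  split=> [|] h; apply: (eqpm_trans h); last by apply/eqpmP; exists e.
  by apply: eqpmC; apply/eqpmP; exists e.
split=> [/hE[] h|[] h]; [constructor 1|constructor 2|constructor 3|
   apply/hE; constructor 1|apply/hE; constructor 2|apply/hE; constructor 3] => //.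
- by apply/eA; apply: eqpm_trans h _.
- by apply: eqpm_trans h _.
- by apply: eqpm_trans ((eA _).2 h) pq.
- by apply: eqpm_trans h (eqpmC _).
Qed.

(** The cube of [B] is the identity, so the orbit may start at any of its members. *)
Lemma orbit_shift E (B : 'rV[R]_2 -> 'rV[R]_2) p w : linear B ->
  (forall x, B (B x) = - B x - x) ->
  (forall x, E x <-> [\/ eqpm x p, eqpm x (B p) | eqpm x (B (B p))]) ->
  E w -> forall x, E x <-> [\/ eqpm x w, eqpm x (B w) | eqpm x (B (B w))].
Proof.
move=> lB BB hE Ew.
have BBB y : B (B (B y)) = y by rewrite !BB opprD !opprK addrAC subrr add0r.
have im y z : eqpm y z -> eqpm (B y) (B z) by apply: eqpm_image.
have tr y z x (h : eqpm y z) : eqpm x z <-> eqpm x y.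
  by split=> /eqpm_trans; apply; [apply: eqpmC|].
have same y z x : eqpm y z ->
    [\/ eqpm x z, eqpm x (B z) | eqpm x (B (B z))] <->
    [\/ eqpm x y, eqpm x (B y) | eqpm x (B (B y))].
  move=> h; have h1 := tr _ _ x h; have h2 := tr _ _ x (im _ _ h).
  have h3 := tr _ _ x (im _ _ (im _ _ h)).
  by split=> -[?|?|?]; [constructor 1; apply/h1|constructor 2; apply/h2|
    constructor 3; apply/h3|constructor 1; apply/h1|constructor 2; apply/h2|
    constructor 3; apply/h3].
move=> x; apply: (iff_trans (hE x)).
move/hE: Ew => [] h; apply: iff_trans (same _ _ x h); rewrite ?BBB //.
- by split=> -[]; [constructor 3|constructor 1|constructor 2|constructor 2|
    constructor 3|constructor 1].
- by split=> -[]; [constructor 2|constructor 3|constructor 1|constructor 3|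
    constructor 1|constructor 2].
Qed.

(** * Vertices on the long sides of an extremal rectangle *)

Section Top_edge.
Variables (H : set 'rV[R]_2) (Q : rectangle R) (p q : 'rV[R]_2).
Hypotheses (hs : o_symmetric H) (HE : H = convex_hull (extreme_points H)).
Hypotheses (fE : finite_set (extreme_points H)) (exQ : extremal_rectangle H Q).
Hypotheses (Hp : H p) (Hq : H q) (pq : det2 p q != 0).

Let k := aspect_ratio Q.
Let E := extreme_points H.
Let X x := dot x (long_dir Q).
Let Y x := dot x (short_dir Q).

(** This is [extremal_support] in the direction [long_dir Q + t *: short_dir Q]. The orientation [s]
    of the frame is absorbed by passing from [e] to its opposite. *)
Lemma extremal_frame x t : H x ->
  exists2 e, E e & k * (X x + t * Y x) <= Y e - t * X e.
Proof.
move=> Hx; have u1 := short_dir1 Q; have v1 := long_dir1 Q.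
have uv := dir_orthogonal Q.
have vu : dot (long_dir Q) (short_dir Q) = 0 by rewrite dotC.
pose s := dot (rot90 (long_dir Q)) (short_dir Q).
have ss : s * s = 1.
  have := dot_sqr_rot90 (long_dir Q) (short_dir Q).
  by rewrite vu u1 v1 expr0n /= add0r mulr1.
have rv : rot90 (long_dir Q) = s *: short_dir Q.
  apply: (frame_eq u1 v1 uv); first by rewrite dotZl u1 mulr1.
  by rewrite dotC dot_rot90r dotZl uv mulr0.
have ru : rot90 (short_dir Q) = - s *: long_dir Q.
  rewrite -[X in rot90 X]scale1r -ss -scalerA -rv rot90Z rot90rot90.
  by rewrite scalerN scaleNr.
have [e Ee] :=
  extremal_support (long_dir Q + t *: short_dir Q) hs HE fE Hp Hq pq exQ Hx.
rewrite rot90D rot90Z rv ru !dotlin => h; exists (s *: e).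
  have [->|->] : eqpm (s *: e) e by apply/eqpmP; exists s.
    by [].
  exact: extremeN.
by rewrite /X /Y !dotZl; rewrite -/k in h; lra.
Qed.

(* If the vertex w were alone on its long side of the extremal rectangle, turning
   the rectangle slightly would show that w is orthogonal to every vertex v on a
   short side; but w + B w + B (B w) = 0 forbids it. *)
Lemma exists_vertex_on_axis (B : 'rV[R]_2 -> 'rV[R]_2) z :
  linear B -> (forall x, B (B x) = - B x - x) ->
  (forall x, E x <-> [\/ eqpm x z, eqpm x (B z) | eqpm x (B (B z))]) ->
  exists2 x, E x & Y x = 0.
Proof.
move=> lB BB hE.
have [hv hu [xv Hxv xvE] [xu Hxu xuE]] := circumscribed_bounds hs exQ.1.
set X0 := long_len Q / 2 in hv xvE; set Y0 := short_len Q / 2 in hu xuE.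
have X0_gt0 : 0 < X0 by rewrite divr_gt0 ?long_len_gt0.
have Y0_gt0 : 0 < Y0 by rewrite divr_gt0 ?short_len_gt0.
have k0 : 0 < k := aspect_gt0 Q; have k1 : k <= 1 := aspect_le1 Q.
have kX : k * X0 = Y0 by rewrite mulrA divfK// gt_eqF// long_len_gt0.
have E0 : E !=set0 by exists z; apply/hE; constructor 1; left.
have EH e : E e -> H e by case.
have XE e : E e -> - X0 <= X e <= X0.
  move=> /EH He; have := hv _ He; have := hv _ (o_symmetricN hs He).
  by rewrite dotNl -/(X e) => *; apply/andP; split; lra.
have YE e : E e -> - Y0 <= Y e <= Y0.
  move=> /EH He; have := hu _ He; have := hu _ (o_symmetricN hs He).
  by rewrite dotNl -/(Y e) => *; apply/andP; split; lra.
move: Hxu Hxv; rewrite HE => /(hull_dot_attained (short_dir Q) fE E0)[w Ew].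
rewrite xuE -/(Y w) => wY /(hull_dot_attained (long_dir Q) fE E0)[v Ev].
rewrite xvE -/(X v) => vX.
have {}wY : Y w = Y0 by have /andP[_] := YE _ Ew; lra.
have {}vX : X v = X0 by have /andP[_] := XE _ Ev; lra.
have {}hE := orbit_shift lB BB hE Ew.
have Ew1 : E (B w) by apply/hE; constructor 2; left.
have Ew2 : E (B (B w)) by apply/hE; constructor 3; left.
have Yw2 : Y (B (B w)) = - Y (B w) - Y0 by rewrite /Y BB !dotlin -/(Y w) wY.
have Xw2 : X (B (B w)) = - X (B w) - X w by rewrite /X BB !dotlin.
apply: contrapT => no.
have {}no e : E e -> Y e != 0 by move=> Ee; apply/eqP => e0; apply: no; exists e.
(* The heights of [w], [B w] and [B (B w)] add up to 0 and none is 0, so the last two lie strictly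
   between [- Y0] and 0. *)
have /andP[y1 y2] : - Y0 < Y (B w) < 0.
  have n1 := no _ Ew1; have := no _ Ew2.
  have /andP[h1 h2] := YE _ Ew2; have /andP[h3 h4] := YE _ Ew1.
  move: h1 h2; rewrite Yw2 => h1 h2 n2; rewrite !lt_neqAle n1 /=.
  apply/andP; split; last by lra.
  by rewrite h3 andbT; apply: contra n2 => /eqP <-; rewrite opprK subrr.
(* The minimum is the gap in height between [w] and the next highest vertex, which is [- B w] or
   [- B (B w)]. *)
have yB e : E e -> e = w \/ Y e <= Y0 - Num.min (Y0 + Y (B w)) (- Y (B w)).
  set m := Num.min _ _.
  have m1 : m <= Y0 + Y (B w) by rewrite /m ge_min lexx.
  have m2 : m <= - Y (B w) by rewrite /m ge_min lexx orbT.
  have N y : Y (- y) = - Y y by rewrite /Y dotNl.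
  by move/hE => [] [] ->; [left|right|right|right|right|right] => //;
    rewrite ?N ?Yw2 ?wY; lra.
move: yB; set m := Num.min _ _ => yB.
have m0 : 0 < m by rewrite /m lt_min; apply/andP; split; lra.
(* For a turn this small the vertex given by [extremal_frame] is [w], the others being too low.
   Taking both signs of [t] then yields [k * Y v + X w = 0], which is orthogonality of [v] and [w]
   because [Y w = k * X v]. *)
have vw t : `|t| * (2 * X0) < m -> t * (k * Y v + X w) <= 0.
  move=> tm; have [e Ee] := extremal_frame t (EH _ Ev); rewrite vX mulrDr kX.
  case: (yB _ Ee) => [->|Ym]; first by rewrite wY; lra.
  move=> h; exfalso; have {h} h : m <= - (t * (k * Y v + X e)) by lra.
  have b : `|k * Y v + X e| <= 2 * X0.
    have /andP[? ?] := XE _ Ee; have /andP[? ?] := YE _ Ev.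
    by rewrite ler_norml; apply/andP; split; nra.
  have := ler_norm (- (t * (k * Y v + X e))); rewrite normrN normrM.
  have : `|t| * `|k * Y v + X e| <= `|t| * (2 * X0) by rewrite ler_wpM2l.
  lra.
have {vw} vw : k * Y v + X w = 0.
  pose t := m / (4 * X0).
  have t0 : 0 < t by rewrite divr_gt0// mulr_gt0.
  have tX : t * (4 * X0) = m by rewrite divfK// gt_eqF// mulr_gt0.
  have := vw t; have := vw (- t); rewrite normrN gtr0_norm//.
  have -> : t * (2 * X0) < m by lra.
  move=> /(_ isT) h1 /(_ isT) h2; nra.
have /andP[x1 x2] := XE _ Ew2; have /andP[x3 x4] := XE _ Ew1.
have NX y : X (- y) = - X y by rewrite /X dotNl.
have NY y : Y (- y) = - Y y by rewrite /Y dotNl.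
(* For [v] equal to [w] or [- w] orthogonality fails outright. Otherwise [B w] or [B (B w)] has
   abscissa [X0] or [- X0]; since the three abscissas add up to 0, the sign of [X w] is opposite to
   the one orthogonality requires. *)
by move/hE: Ev vX vw => [] [] ->; rewrite ?NX ?NY ?Yw2 ?wY; nra.
Qed.

End Top_edge.
End Permuted_vertices.

(** * The triangle T0 and squares *)

Section Conclusion.
Context {R : realType}.
Implicit Types (p q r x y z u v : 'rV[R]_2) (a b t : R) (H E : set 'rV[R]_2).
Implicit Types Q : rectangle R.

(** Cardano's formula: with [v = 20 / c], the number [y = v - c] satisfies
    [y ^+ 3 + 60 * y + 88 = 0], and [x0 R = (4 + y) / 6]. *)
Lemma x0_root : x0 R ^+ 3 - 2 * x0 R ^+ 2 + 3 * x0 R - 1 = 0.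
Proof.
pose s : R := Num.sqrt 69; pose c : R := (44 + 12 * s) `^ 3^-1.
have s0 : 0 <= s by exact: sqrtr_ge0.
have ss : s * s = 69 by rewrite -expr2 sqr_sqrtr.
have c0 : 0 < c by rewrite powR_gt0//; lra.
have c3 : c ^+ 3 = 44 + 12 * s.
  rewrite /c -powR_mulrn ?powR_ge0// -powRrM mulVf ?pnatr_eq0// powRr1//; lra.
pose v := 20 / c.
have cv : c * v = 20 by rewrite mulrC divfK// gt_eqF.
have v3 : v ^+ 3 = c ^+ 3 - 88.
  have c30 : c ^+ 3 != 0 by rewrite expf_neq0// gt_eqF.
  apply: (mulfI c30); rewrite -exprMn cv c3; lra.
have -> : x0 R = (4 + (v - c)) / 6.
  by rewrite /x0 -/s -/c /v; field; rewrite gt_eqF.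
have m3 : (v - c) ^+ 3 = - 88 - 60 * (v - c).
  have -> : (v - c) ^+ 3 = v ^+ 3 - c ^+ 3 - 3 * (c * v) * (v - c) by ring.
  by rewrite v3 cv; ring.
transitivity (((v - c) ^+ 3 + 60 * (v - c) + 88) / 216); first by field.
by rewrite m3; field.
Qed.

(** The cubic has one real root: in the difference of its values at [t] and [s], the cofactor of
    [t - s] is always positive. *)
Lemma x0_unique t : t ^+ 3 - 2 * t ^+ 2 + 3 * t - 1 = 0 -> t = x0 R.
Proof.
move=> ht; have hx := x0_root; move: (x0 R) hx => s hs.
have : (t - s) * (t ^+ 2 + t * s + s ^+ 2 - 2 * (t + s) + 3) = 0.
  transitivity ((t ^+ 3 - 2 * t ^+ 2 + 3 * t - 1)
    - (s ^+ 3 - 2 * s ^+ 2 + 3 * s - 1)); first by ring.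
  by rewrite ht hs subrr.
move/eqP; rewrite mulf_eq0 => /orP[|/eqP]; first by rewrite subr_eq0 => /eqP.
have := sqr_ge0 (t + s - 4 / 3); have := sqr_ge0 t; have := sqr_ge0 s.
by rewrite !expr2; nra.
Qed.

(** Half of each edge vector of the triangle, with both signs. *)
Definition hexagon_T0 : set 'rV[R]_2 := [set x | [\/ eqpm x (pt 2^-1 0),
  eqpm x (pt (x0 R / 2) 2^-1) | eqpm x (pt ((1 - x0 R) / 2) (- 2^-1))]].

(** The difference is affine in each argument, so one inclusion reduces to pairs of vertices of the
    triangle; the other holds because the half difference body is convex. *)
Lemma half_difference_body_T0 :
  half_difference_body (triangle_T0 R) = convex_hull hexagon_T0.
Proof.
set r := x0 R; set h := 2^-1 : R.
have T1 : triangle_T0 R (pt 0 0) by apply: sub_hull; left; left.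
have T2 : triangle_T0 R (pt 1 0) by apply: sub_hull; left; right.
have T3 : triangle_T0 R (pt r 1) by apply: sub_hull; right.
have D p q : triangle_T0 R p -> triangle_T0 R q ->
  half_difference_body (triangle_T0 R) (h *: (p - q)).
  by move=> Tp Tq; exists p => //; exists q.
apply/seteqP; split; last first.
  apply: hull_min.
    move=> _ _ t [p Tp [q Tq <-]] [p' Tp' [q' Tq' <-]] t0 t1.
    exists (t *: p + (1 - t) *: p'); first exact: hull_convex.
    exists (t *: q + (1 - t) *: q'); first exact: hull_convex.
    by apply: rV2P; rewrite !mxE; ring.
  have DE x p q : triangle_T0 R p -> triangle_T0 R q -> h *: (p - q) = x ->
      half_difference_body (triangle_T0 R) x by move=> Tp Tq <-; exact: D.
  move=> x [] [] ->; [ apply: DE T2 T1 _ | apply: DE T1 T2 _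
    | apply: DE T3 T1 _ | apply: DE T1 T3 _ | apply: DE T2 T3 _
    | apply: DE T3 T2 _ ]; by apply: rV2P; rewrite !mxE /= /h /r; ring.
have C1 : convex_hull hexagon_T0 (pt h 0).
  by apply: sub_hull; constructor 1; left.
have C1' : convex_hull hexagon_T0 (- pt h 0).
  by apply: sub_hull; constructor 1; right.
have C2 : convex_hull hexagon_T0 (pt (r / 2) h).
  by apply: sub_hull; constructor 2; left.
have C2' : convex_hull hexagon_T0 (- pt (r / 2) h).
  by apply: sub_hull; constructor 2; right.
have C3 : convex_hull hexagon_T0 (pt ((1 - r) / 2) (- h)).
  by apply: sub_hull; constructor 3; left.
have C3' : convex_hull hexagon_T0 (- pt ((1 - r) / 2) (- h)).
  by apply: sub_hull; constructor 3; right.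
have C0 : convex_hull hexagon_T0 0.
  rewrite (_ : 0 = h *: pt h 0 + (1 - h) *: (- pt h 0)).
    by apply: hull_convex => //; rewrite /h; lra.
  by apply: rV2P; rewrite !mxE /= /h; field.
have cvx p q p' t : convex_hull hexagon_T0 (h *: (p - q)) ->
    convex_hull hexagon_T0 (h *: (p' - q)) -> 0 <= t -> t <= 1 ->
    convex_hull hexagon_T0 (h *: (t *: p + (1 - t) *: p' - q)).
  move=> c1 c2 t0 t1; have := hull_convex c1 c2 t0 t1; congr convex_hull.
  by apply: rV2P; rewrite !mxE; ring.
have cvx' p q q' t : convex_hull hexagon_T0 (h *: (p - q)) ->
    convex_hull hexagon_T0 (h *: (p - q')) -> 0 <= t -> t <= 1 ->
    convex_hull hexagon_T0 (h *: (p - (t *: q + (1 - t) *: q'))).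
  move=> c1 c2 t0 t1; have := hull_convex c1 c2 t0 t1; congr convex_hull.
  by apply: rV2P; rewrite !mxE; ring.
move=> _ [p Tp [q Tq <-]]; rewrite -/h.
move: p Tp; apply: hull_min => [p p' t|p Vp]; first exact: cvx.
move: q Tq; apply: hull_min => [q q' t|q Vq]; first exact: cvx'.
(* Of the nine pairs, the three equal ones give 0 and the other six give the points of
   [hexagon_T0]. *)
case: Vp => [[]|] ->; case: Vq => [[]|] ->; rewrite ?subrr ?scaler0 //.
all: match goal with |- convex_hull _ ?x => first
 [ have -> : x = pt h 0
     by apply: rV2P; rewrite !mxE /= /h /r; ring
 | have -> : x = - pt h 0
     by apply: rV2P; rewrite !mxE /= /h /r; ring
 | have -> : x = pt (r / 2) h
     by apply: rV2P; rewrite !mxE /= /h /r; ring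
 | have -> : x = - pt (r / 2) h
     by apply: rV2P; rewrite !mxE /= /h /r; ring
 | have -> : x = pt ((1 - r) / 2) (- h)
     by apply: rV2P; rewrite !mxE /= /h /r; ring
 | have -> : x = - pt ((1 - r) / 2) (- h)
     by apply: rV2P; rewrite !mxE /= /h /r; ring ]
 end => //.
Qed.

(** The segments from [- e] to [e] and from [- f] to [f] are the diagonals; the sides are parallel
    to [e + f] and [e - f], with corner [- e]. *)
Lemma square_hull (e f : 'rV[R]_2) : dot e f = 0 -> dot f f = dot e e -> e != 0 ->
  is_square (convex_hull [set x | eqpm x e \/ eqpm x f]).
Proof.
move=> ef ff e0; have L0 := dot_gt0 e0; set L := dot e e in ff L0.
have fe : dot f e = 0 by rewrite dotC.
pose l := Num.sqrt (2 * L).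
have l0 : 0 < l by rewrite sqrtr_gt0 mulr_gt0.
have ln0 : l != 0 by rewrite gt_eqF.
have ll : l * l = 2 * L by rewrite -expr2 sqr_sqrtr// mulr_ge0// ltW.
pose u := l^-1 *: (e + f); pose v := l^-1 *: (e - f).
have il : l^-1 * (l^-1 * (2 * L)) = 1 by rewrite -ll; field.
have u1 : dot u u = 1.
  by rewrite /u !dotlin ef fe ff -/L -[RHS]il; ring.
have v1 : dot v v = 1.
  by rewrite /v !dotlin ef fe ff -/L -[RHS]il; ring.
have uv : dot u v = 0 by rewrite /u /v !dotlin ef fe ff -/L; ring.
have vu : dot v u = 0 by rewrite dotC.
have u1' : enorm u = 1 by apply/enorm1P.
have v1' : enorm v = 1 by apply/enorm1P.
exists (Rectangle (- e) u1' v1' uv l0 (lexx l)) => //.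
have Ll : l^-1 * L = l / 2.
  by rewrite -[L](mulKf (x := 2)) ?pnatr_eq0// -ll; field.
have eu : dot e u = l / 2 by rewrite /u !dotlin ef -/L -Ll; ring.
have ev : dot e v = l / 2 by rewrite /v !dotlin ef -/L -Ll; ring.
have fu : dot f u = l / 2 by rewrite /u !dotlin fe ff -Ll; ring.
have fv : dot f v = - (l / 2) by rewrite /v !dotlin fe ff -Ll; ring.
apply/seteqP; split=> z.
  move=> hz.
  have nl : - (l / 2) <= l / 2 by rewrite ge0_cp// divr_ge0// ltW.
  have bnd w : dot e w = l / 2 \/ dot e w = - (l / 2) ->
      dot f w = l / 2 \/ dot f w = - (l / 2) -> dot z w <= l / 2.
    by move=> [ew|ew] [fw|fw]; move: z hz; apply: hull_dot_le => y [] [] ->;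
      rewrite ?dotNl ?ew ?fw ?opprK ?lexx ?nl.
  have bu : - (l / 2) <= dot z u.
    by rewrite lerNl -dotNr; apply: bnd; right; rewrite dotNr ?eu ?fu.
  have bv : - (l / 2) <= dot z v.
    rewrite lerNl -dotNr; apply: bnd; [right|left]; rewrite dotNr ?ev ?fv//.
    exact: opprK.
  have bu' : dot z u <= l / 2 by apply: bnd; left.
  have bv' : dot z v <= l / 2 by apply: bnd; [left|right].
  have itv c : - (l / 2) <= c -> c <= l / 2 -> c + l / 2 \in `[0, l].
    by clear => *; rewrite in_itv /=; apply/andP; split; lra.
  exists (dot z u + l / 2); first exact: itv.
  exists (dot z v + l / 2); first exact: itv.
  clearbody u v; apply: (frame_eq u1 v1 uv);
    by rewrite !dotlin ?u1 ?v1 ?uv ?vu ?eu ?ev; ring.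
move=> [s s01 [t t01 <-]] /=; move: s01 t01; rewrite /= !in_itv /=.
move=> /andP[s0 s1] /andP[t0 t1].
set s' := l^-1 * s; set t' := l^-1 * t.
have s'0 : 0 <= s' by rewrite mulr_ge0// invr_ge0 ltW.
have t'0 : 0 <= t' by rewrite mulr_ge0// invr_ge0 ltW.
have s'1 : s' <= 1 by rewrite /s' mulrC ler_pdivrMr// mul1r.
have t'1 : t' <= 1 by rewrite /t' mulrC ler_pdivrMr// mul1r.
(* Bilinear interpolation between the four corners. *)
have -> : - e + s *: u + t *: v = s' *: (t' *: e + (1 - t') *: f)
    + (1 - s') *: (t' *: (- f) + (1 - t') *: (- e)).
  by apply: rV2P; rewrite /u /v !mxE /s' /t'; ring.
by apply: hull_convex => //; apply: hull_convex => //; apply: sub_hull;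
  by [left; left|left; right|right; left|right; right].
Qed.

End Conclusion.

(** * Weakly invariant hexagons *)

Section Weakly_invariant_polygons.
Context {R : realType}.
Implicit Types (p q r x y z u v e f : 'rV[R]_2) (a b t : R).
Implicit Types (H E : set 'rV[R]_2) (Q : rectangle R).

(** The origin is the midpoint of [y] and [- y] for every [y] in [H]; were it extreme, [H] would be
    a single point. *)
Lemma extreme_neq0 H n x : o_symmetric H -> (extreme_points H #= `I_n)%card ->
  (1 < n)%N -> extreme_points H x -> x != 0.
Proof.
move=> hs En n1 Ex; apply/eqP => x0; rewrite {x}x0 in Ex.
have E0 : extreme_points H = [set 0].
  apply/seteqP; split=> [y [Hy _]|_ ->//] /=.
  have h01 : 0 < (2^-1 : R) < 1 by apply/andP; split; lra.
  have [] := Ex.2 y (- y) 2^-1 Hy (o_symmetricN hs Hy) h01 => //.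
  have -> : 1 - 2^-1 = 2^-1 :> R by lra.
  by rewrite scalerN subrr.
have : (`I_1 #= `I_n)%card.
  by apply: card_eq_trans En; rewrite E0 card_eq_sym card_set1.
by move/card_eq_II => n1'; rewrite -n1' in n1.
Qed.

Section Aspect_ratio_one.
Variable E : set 'rV[R]_2.
Hypotheses (fE : finite_set E) (E0 : E !=set0).
Hypothesis E_neq0 : forall x, E x -> x != 0.
(** This is [extremal_support] at ratio one. Iterated over four quarter turns, it says that the
    support function of the hull of [E] is invariant under the quarter turn. *)
Hypothesis hE : forall n x, E x -> exists2 e, E e & dot x n <= dot e (rot90 n).

(** Equality in Cauchy-Schwarz: for a longest [e], the hypothesis in direction [e] gives [f] with
    [dot f (rot90 e) >= dot e e]; as [f] is no longer than [e], it is [rot90 e]. *)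
Lemma longest_orthogonal : exists e f, [/\ E e, E f, dot e f = 0,
  dot f f = dot e e & forall x, E x -> dot x x <= dot e e].
Proof.
have [e Ee he] := finite_argmax (fun x => dot x x) fE E0.
have [f Ef ef] := hE e Ee; exists e, f.
have L0 := dot_gt0 (E_neq0 Ee); have fe := he _ Ef.
have := dot_sqr_rot90 e f; move: ef; rewrite (dotC f).
set c := dot (rot90 e) f; set s := dot e f; set L := dot e e in L0 fe *.
set M := dot f f in fe * => Lc sc.
have cc : L * L <= c * c by nra.
have s0 : s = 0 by apply/eqP; rewrite -sqrf_eq0 expr2; apply/eqP; nra.
have LM : L * L <= L * M by move: sc; rewrite s0 !expr2; lra.
by split=> //; apply/eqP; rewrite eq_le fe /=; nra.
Qed.

End Aspect_ratio_one.

Lemma orthogonal_not_eqpm e f : e != 0 -> dot e f = 0 -> ~ eqpm f e.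
Proof.
move=> /dot_gt0 e0 ef; case=> h; move: ef; rewrite h ?dotNr => /eqP.
  by rewrite gt_eqF.
by rewrite oppr_eq0 gt_eqF.
Qed.

Lemma two_classes E p q e f : (forall x, E x <-> eqpm x p \/ eqpm x q) ->
  E e -> E f -> ~ eqpm f e -> forall x, E x <-> eqpm x e \/ eqpm x f.
Proof.
move=> hE /hE[] ee /hE[] ff nef x; apply: (iff_trans (hE x)).
- by case: nef; apply: eqpm_trans ff (eqpmC ee).
- split=> -[h|h]; [left|right|left|right]; apply: eqpm_trans h _ => //;
  exact: eqpmC.
- split=> -[h|h]; [right|left|right|left]; apply: eqpm_trans h _ => //;
  exact: eqpmC.
- by case: nef; apply: eqpm_trans ff (eqpmC ee).
Qed.

(** Lets the orthogonal pair [e], [f] replace two of the given representatives, [g] being the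
    remaining one. *)
Lemma three_classes E p q r e f :
  (forall x, E x <-> [\/ eqpm x p, eqpm x q | eqpm x r]) ->
  ~ eqpm q p -> ~ eqpm r p -> ~ eqpm r q ->
  E e -> E f -> ~ eqpm f e ->
  exists g, [/\ ~ eqpm g e, ~ eqpm g f &
    forall x, E x <-> [\/ eqpm x e, eqpm x f | eqpm x g]].
Proof.
move=> hE qp rp rq Ee Ef nef.
have tr x y z : eqpm x y -> eqpm z y -> eqpm x z.
  by move=> h /eqpmC; apply: eqpm_trans.
have nc x y z : ~ eqpm x y -> eqpm z y -> ~ eqpm x z.
  by move=> nxy zy xz; apply: nxy; apply: eqpm_trans xz zy.
have pq : ~ eqpm p q by move/eqpmC.
have pr : ~ eqpm p r by move/eqpmC.
have qr : ~ eqpm q r by move/eqpmC.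
have ch x y z : eqpm y z -> (eqpm x y -> eqpm x z) /\ (eqpm x z -> eqpm x y).
  by move=> h; split=> /eqpm_trans; apply=> //; exact: eqpmC.
move/hE: Ee => [] he; move/hE: Ef => [] hf; try by case: nef; apply: tr hf he.
all: [> exists r | exists q | exists r | exists p | exists q | exists p].
all: split; [exact: nc he | exact: nc hf | move=> x; apply: (iff_trans (hE x))].
all: have [h1 h2] := ch x _ _ he; have [h3 h4] := ch x _ _ hf.
all: by split=> -[h|h|h];
  solve [constructor 1; auto | constructor 2; auto | constructor 3; auto].
Qed.

Lemma rot90_pair e f : e != 0 -> dot e f = 0 -> dot f f = dot e e ->
  exists2 t, t * t = 1 & rot90 e = t *: f /\ rot90 f = - t *: e.
Proof.
move=> e0 ef ff; have L0 := dot_gt0 e0.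
have Ln0 : dot e e != 0 by rewrite gt_eqF.
pose t := dot (rot90 e) f / dot e e.
have tE : dot (rot90 e) f = t * dot e e by rewrite divfK.
have tt : t * t = 1.
  apply: (mulIf Ln0); apply: (mulIf Ln0).
  have := dot_sqr_rot90 e f; rewrite ef ff tE expr0n /= add0r expr2 => h.
  by rewrite mul1r -h; ring.
have re : rot90 e = t *: f.
  apply/eqP; rewrite -subr_eq0 -dot_eq0 !dotlin dot_rot90_rot90 tE.
  rewrite (dotC f) tE ff; apply/eqP.
  by transitivity ((1 - t * t) * dot e e); [ring | rewrite tt subrr mul0r].
exists t => //; split=> //.
by rewrite -[f]scale1r -tt -scalerA -re rot90Z rot90rot90 scalerN scaleNr.
Qed.

Lemma hexagon_aspect_not_one H p q r : o_symmetric H ->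
  H = convex_hull (extreme_points H) ->
  let E := extreme_points H in finite_set E ->
  (forall x, E x <-> [\/ eqpm x p, eqpm x q | eqpm x r]) ->
  ~ eqpm q p -> ~ eqpm r p -> ~ eqpm r q -> (forall x, E x -> x != 0) ->
  (forall n x, E x -> exists2 e, E e & dot x n <= dot e (rot90 n)) -> False.
Proof.
move=> hs HE E fE hE qp rp rq E_neq0 hext.
have E0 : E !=set0 by exists p; apply/hE; constructor 1; left.
have [e [f [Ee Ef ef ff he]]] := longest_orthogonal fE E0 E_neq0 hext.
have nef := orthogonal_not_eqpm (E_neq0 _ Ee) ef.
have [g [ge gf {}hE]] := three_classes hE qp rp rq Ee Ef nef.
have Eg : E g by apply/hE; constructor 3; left.
have e0 := E_neq0 _ Ee; have f0 := E_neq0 _ Ef; have g0 := E_neq0 _ Eg.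
have def : det2 e f != 0 by apply: (extreme_det2 hs).
have deg : det2 e g != 0 by apply: (extreme_det2 hs).
have dgf : det2 g f != 0 by rewrite det2C oppr_eq0; apply: (extreme_det2 hs).
have [t tt [re rf]] := rot90_pair e0 ef ff.
have gE := det2_basis g def.
set a := det2 g f / _ in gE; set b := _ / _ in gE.
have a0 : a != 0 by rewrite mulf_neq0// invr_eq0.
have b0 : b != 0 by rewrite mulf_neq0// invr_eq0.
have ab := extreme_coord_gt1 hs HE (proj1 Ee) (proj1 Ef) Eg def gE a0 b0.
clearbody a b; have L0 := dot_gt0 e0; set L := dot e e in ff L0.
have fe : dot f e = 0 by rewrite dotC.
(* In direction [n] the vertex [g] reaches [(|a| + |b|) * L], more than [L]. In the direction turned
   by a right angle, [e] and [f] have absolute value [L] and [g] only [||a| - |b|| * L], so no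
   vertex satisfies the hypothesis. *)
pose n := Num.sg a *: e + Num.sg b *: f.
have sa : Num.sg a * a = `|a| by rewrite normrEsg.
have sb : Num.sg b * b = `|b| by rewrite normrEsg.
have gn : dot g n = (`|a| + `|b|) * L.
  by rewrite gE /n !dotlin ef fe ff -/L -sa -sb; ring.
have rn : rot90 n = t *: (Num.sg a *: f - Num.sg b *: e).
  rewrite /n rot90D !rot90Z re rf; apply: rV2P; rewrite !mxE; ring.
have [x Ex] := hext n g Eg; rewrite gn rn dotZr.
have {}Ex : E (t *: x).
  have [->|->] : eqpm (t *: x) x by apply/eqpmP; exists t.
    by [].
  exact: extremeN.
rewrite -dotZl; move: {x} (t *: x) Ex => x Ex.
have L1 : 1 * L < (`|a| + `|b|) * L by rewrite ltr_pM2r.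
have aL : 0 < `|a| * L by rewrite mulr_gt0// normr_gt0.
have bL : 0 < `|b| * L by rewrite mulr_gt0// normr_gt0.
have sgE (c : R) : c != 0 -> Num.sg c = 1 \/ Num.sg c = -1.
  by case: sgrP => //; [left|right].
have xn y : y = e \/ y = f \/ y = g ->
    `|dot y (Num.sg a *: f - Num.sg b *: e)| < (`|a| + `|b|) * L.
  rewrite ltr_norml => -[->|[->|->]]; rewrite ?gE !dotlin ?ef ?fe ?ff -/L;
    move: L0 L1 aL bL; rewrite -sa -sb;
    by have [->|->] := sgE a a0; have [->|->] := sgE b b0;
      clear => *; apply/andP; split; lra.
have [y yV xy] : exists2 y, y = e \/ y = f \/ y = g & eqpm x y.
  by move/hE: Ex => [] h; [exists e|exists f|exists g]; auto.
have := xn _ yV; rewrite ltr_norml => /andP[h1 h2].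
by rewrite leNgt; case: xy => ->; rewrite ?dotNl => /negP; apply; lra.
Qed.

Lemma weakly_invariant_hexagon H Q p q r : o_symmetric H ->
  H = convex_hull (extreme_points H) -> extremal_rectangle H Q ->
  similar_sets (rect_affinity Q @` H) H -> aspect_ratio Q < 1 ->
  let E := extreme_points H in finite_set E ->
  (forall x, E x <-> [\/ eqpm x p, eqpm x q | eqpm x r]) ->
  ~ eqpm q p -> ~ eqpm r p -> ~ eqpm r q -> (forall x, E x -> x != 0) ->
  similar_sets H (half_difference_body (triangle_T0 R)).
Proof.
move=> hs HE exQ simH k1 E fE hE qp rp rq E_neq0.
have Ep : E p by apply/hE; constructor 1; left.
have Eq : E q by apply/hE; constructor 2; left.
have Er : E r by apply/hE; constructor 3; left.
have p0 := E_neq0 _ Ep; have q0 := E_neq0 _ Eq; have r0 := E_neq0 _ Er.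
have dpq : det2 p q != 0 by apply: (extreme_det2 hs).
have dpr : det2 p r != 0 by apply: (extreme_det2 hs).
have dqr : det2 q r != 0 by apply: (extreme_det2 hs).
have [A [a [b [d [lA AH dd ab hA]]]]] := invariant_frame_map hs exQ.1 simH.
have iA := frame_map_inj lA dd ab hA.
have AE x : E x -> E (A x) := extreme_image lA iA AH.
have [B [a' [b' [z [lB hB a'k kab [BB hEz]]]]]] : exists B a' b' z,
  [/\ linear B, frame_map Q a' b' 1 B, a' * (1 + aspect_ratio Q) = -1,
      aspect_ratio Q * (a' * a' + b' * b') = 1 &
      (forall x, B (B x) = - B x - x) /\
      (forall x, E x <-> [\/ eqpm x z, eqpm x (B z) | eqpm x (B (B z))])].
  case: (permute_pairs6 lA iA AE hE qp rp rq dpq dpr dqr).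
  - move=> [e ee AA].
    by case: (frame_map_no_involution AH dd ab hA hs exQ.1 k1 ee AA).
  - move=> [pq qr rp'].
    have [B [a' [b' hB]]] := three_cycle lA dd ab hA pq qr rp' dpq hE.
    by exists B, a', b', p.
  - move=> [pr rq' qp'].
    have hE' x : E x <-> [\/ eqpm x p, eqpm x r | eqpm x q].
      by apply: iff_trans (hE x) _; split=> -[]; by constructor.
    have [B [a' [b' hB]]] := three_cycle lA dd ab hA pr rq' qp' dpr hE'.
    by exists B, a', b', p.
(* A vertex on the axis parallel to the long sides, with the sign chosen so that it lies on the
   positive half; the orbit of [B] is restarted there. *)
have [w [Ew wY wX]] : exists w,
    [/\ E w, dot w (short_dir Q) = 0 & 0 < dot w (long_dir Q)].
  have [x Ex xY] :=
    exists_vertex_on_axis hs HE fE exQ (proj1 Ep) (proj1 Eq) dpq lB BB hEz.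
  have xX : dot x (long_dir Q) != 0.
    apply: contra (E_neq0 _ Ex) => /eqP xX; apply/eqP.
    by apply: (frame_eq (short_dir1 Q) (long_dir1 Q) (dir_orthogonal Q));
      rewrite ?xX ?xY dot0l.
  have [x_gt0|x_le0] := ltP 0 (dot x (long_dir Q)); first by exists x.
  exists (- x); split; first exact: extremeN.
    by rewrite dotNl xY oppr0.
  by rewrite dotNl oppr_gt0 lt_neqAle xX.
have {z} {}hEz := orbit_shift lB BB hEz Ew.
have [hv hu [xv Hxv xvE] [xu Hxu xuE]] := circumscribed_bounds hs exQ.1.
have E0 : E !=set0 by exists p.
have EH e : E e -> H e by case.
have k0 := aspect_gt0 Q; have k1' := ltW k1.
have kX : aspect_ratio Q * (long_len Q / 2) = short_len Q / 2.
  by rewrite mulrA divfK// gt_eqF// long_len_gt0.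
move: Hxu Hxv; rewrite HE => /(hull_dot_attained (short_dir Q) fE E0)[y Ey].
rewrite xuE => yY /(hull_dot_attained (long_dir Q) fE E0)[x Ex].
rewrite xvE => xX.
have := hu _ (EH _ Ey); have := hv _ (EH _ Ex); have := hv _ (EH _ Ew).
have Ew1 : E (B w) by apply/hEz; constructor 2; left.
have := hu _ (EH _ Ew1); have := hu _ (o_symmetricN hs (EH _ Ew1)).
have [X1 Y1] := hB w; move: X1 Y1; rewrite wY !mulr0 subr0 addr0 dotNl => X1 Y1.
have X2 : dot (B (B w)) (long_dir Q) = - dot (B w) (long_dir Q) - dot w (long_dir Q).
  by rewrite BB !dotlin.
have Y2 : dot (B (B w)) (short_dir Q) = - dot (B w) (short_dir Q).
  by rewrite BB !dotlin wY oppr0 addr0.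
have L0 := long_len_gt0 Q; have S0 := short_len_gt0 Q.
move: kX xX yY a'k kab k0 k1'.
set k := aspect_ratio Q in X1 Y1 *.
set X0 := long_len Q / 2; set Y0 := short_len Q / 2.
set W := dot w (long_dir Q) in wX X1 Y1 X2 *.
move=> kX xX yY a'k kab k0 k1' h1 h2 h3 h4 h5.
have X0_gt0 : 0 < X0 by rewrite divr_gt0.
(* From [a' * (1 + k) = -1], the axis coordinates of [B w] and [B (B w)] lie strictly between [- W]
   and 0. So the short side must be touched by [w], that is, [W = X0]. *)
have a1 : -1 < a' by clear -a'k k0; nra.
have ka0 : k * a' < 0 by lra.
have a2 : a' < 0 by clear -a'k k0; nra.
have kaW : - W < k * a' * W.
  by rewrite -mulN1r ltr_pM2r//; clear -a2 a'k; lra.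
have kaW0 : k * a' * W < 0 by rewrite nmulr_rlt0.
have WX : W = X0.
  suff : X0 <= W by lra.
  by move/hEz: Ex xX => [] [] ->; rewrite ?dotNl ?X2 ?X1 -/W;
    clear -kaW kaW0 wX; lra.
(* Since [w] has height 0, a long side is touched by [B w], [B (B w)] or an opposite; their heights
   are [b' * (k * X0)] up to sign, and [k * X0 = Y0]. *)
have bb : b' * b' = 1.
  rewrite Y1 WX in h1 h2; have kX_gt0 : 0 < k * X0 by rewrite mulr_gt0.
  have b1 : `|b'| <= 1.
    rewrite ler_norml; apply/andP; split; rewrite -(ler_pM2r kX_gt0);
      move: h1 h2 kX; clear; lra.
  have b2 : 1 <= `|b'|.
    rewrite -(ler_pM2r kX_gt0) mul1r kX.
    have n1 : b' * (k * X0) <= `|b'| * (k * X0) by rewrite ler_pM2r// ler_norm.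
    have n2 : - b' * (k * X0) <= `|b'| * (k * X0).
      by rewrite ler_pM2r// -normrN ler_norm.
    have n3 : 0 <= `|b'| * (k * X0) by rewrite mulr_ge0// ltW.
    rewrite -kX in yY *; move/hEz: Ey yY => [] [] ->;
      rewrite ?dotNl ?Y2 ?wY ?Y1 ?opprK ?oppr0 ?WX; move: n1 n2 n3 kX_gt0;
      clear; lra.
  have : `|b'| = 1 by lra.
  by move=> b3; rewrite -[b' * b']ger0_norm ?normrM ?b3 ?mulr1// -expr2 sqr_ge0.
have a_x0 : x0 R = 1 + a'.
  apply/esym/x0_unique; rewrite bb in kab.
  (* This combination of [a' * (1 + k) = -1] and [k * (a' * a' + 1) = 1] eliminates [k]. *)
  transitivity (a' * (1 + k) * (a' * a' + 1) + (a' * a' + 1)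
    + a' * (1 - k * (a' * a' + 1))); first by ring.
  by rewrite kab a'k; ring.
have Wn0 : W != 0 by rewrite gt_eqF.
(* [G] is fixed by its values on the basis [w], [B w], sent to vertices of [hexagon_T0] up to the
   sign [b']; the image of [B (B w)] follows from the zero sum. As [b' * b' = 1], its rows are
   orthogonal and equally long, so it is a similarity. *)
pose G x := pt
  ((2 * W)^-1 * (- (b' * a') * dot x (long_dir Q) - dot x (short_dir Q)))
  ((2 * W)^-1 * (a' * dot x (short_dir Q) - b' * dot x (long_dir Q))).
have lG : linear G.
  by move=> t y1 y2; apply: rV2P; rewrite !mxE /= !dotlin; ring.
have Gw : G w = b' *: pt ((1 - x0 R) / 2) (- 2^-1).
  by rewrite /G wY -/W a_x0; apply: rV2P; rewrite !mxE /=; field.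
have GBw : G (B w) = - b' *: pt 2^-1 0.
  rewrite /G X1 Y1; apply: rV2P; rewrite !mxE /=; last by field.
  transitivity (k * (a' * a' + b' * b') * (- b' / 2)).
    by rewrite bb; field.
  by rewrite kab; field.
have GBBw : G (B (B w)) = b' *: pt (x0 R / 2) 2^-1.
  rewrite BB (linD lG) !(linN lG) Gw GBw.
  by apply: rV2P; rewrite !mxE /=; field.
have GE : G @` E = hexagon_T0.
  have ch y1 y2 y3 : eqpm y2 y3 -> eqpm y1 y2 -> eqpm y1 y3.
    by move=> h /eqpm_trans; apply.
  have c1 : eqpm (G w) (pt ((1 - x0 R) / 2) (- 2^-1)).
    by apply/eqpmP; exists b'.
  have c2 : eqpm (G (B w)) (pt 2^-1 0).
    by apply/eqpmP; exists (- b'); rewrite ?mulrNN.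
  have c3 : eqpm (G (B (B w))) (pt (x0 R / 2) 2^-1).
    by apply/eqpmP; exists b'.
  have img y1 y2 : E y2 -> eqpm y1 (G y2) -> exists2 e, E e & G e = y1.
    move=> Ey2 [->|->]; first by exists y2.
    by exists (- y2); [exact: extremeN | rewrite (linN lG)].
  apply/seteqP; split=> [_ [y1 /hEz[] h <-]|y1 [] h].
  - by constructor 3; apply: ch c1 _; apply: eqpm_image.
  - by constructor 1; apply: ch c2 _; apply: eqpm_image.
  - by constructor 2; apply: ch c3 _; apply: eqpm_image.
  - by apply: img Ew1 _; apply: ch (eqpmC c2) h.
  - apply: (img _ (B (B w))); first by apply/hEz; constructor 3; left.
    by apply: ch (eqpmC c3) h.
  - by apply: img Ew _; apply: ch (eqpmC c1) h.
rewrite half_difference_body_T0 -GE -image_hull// -HE; exists G => //.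
pose c := (a' * a' + 1) * ((2 * W)^-1 * (2 * W)^-1).
have c0 : 0 < c.
  have W2 : 0 < (2 * W)^-1 by rewrite invr_gt0 mulr_gt0.
  by rewrite mulr_gt0 ?mulr_gt0//; have := sqr_ge0 a'; rewrite expr2; lra.
exists (Num.sqrt c); first by rewrite sqrtr_gt0.
move=> y1 y2; rewrite -(linN lG) -(linD lG) /enorm -sqrtrM ?ltW//.
move: (y1 - y2) => {y1 y2} v; congr Num.sqrt.
rewrite (frame_dot (short_dir1 Q) (long_dir1 Q) (dir_orthogonal Q) v) dotE.
rewrite !mxE /= /c.
set V1 := dot v (short_dir Q); set V2 := dot v (long_dir Q).
transitivity ((2 * W)^-1 * (2 * W)^-1 * (a' * a' * V1 * V1 + V1 * V1
  + (b' * b') * (a' * a' * V2 * V2 + V2 * V2))); first by ring.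
by rewrite bb; ring.
Qed.

Lemma extremal_support_square H Q p q : o_symmetric H ->
  H = convex_hull (extreme_points H) -> finite_set (extreme_points H) ->
  H p -> H q -> det2 p q != 0 -> extremal_rectangle H Q ->
  aspect_ratio Q = 1 -> forall n x, extreme_points H x ->
  exists2 e, extreme_points H e & dot x n <= dot e (rot90 n).
Proof.
move=> hs HE fE Hp Hq dpq exQ k1 n x [Hx _].
have [e Ee] := extremal_support n hs HE fE Hp Hq dpq exQ Hx.
by rewrite k1 mul1r => h; exists e.
Qed.

End Weakly_invariant_polygons.

(** * Case distinction by the number of vertices and the aspect ratio *)

Theorem theorem4 (R : realType) (H : set 'rV[R]_2)
  (hexH : o_symmetric_hexagon H \/ degenerate_o_symmetric_hexagon H)
  (invH : weakly_invariant H) :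
  is_square H \/ similar_sets H (half_difference_body (triangle_T0 R)).
Proof.
case: invH => Q exQ simH.
have k1 := aspect_le1 Q.
case: hexH => -[hs [En HE _]].
- have fE : finite_set (extreme_points H) by apply/finite_setP; exists 6%N.
  have E_neq0 x : extreme_points H x -> x != 0 by apply: extreme_neq0 En _.
  have [|p [q [r [p0 q0 r0 [qp rp rq hE]]]]] := sym_set6 En (fun x => extremeN hs).
    by move=> /E_neq0; rewrite eqxx.
  have Ep : extreme_points H p by apply/hE; constructor 1; left.
  have Eq : extreme_points H q by apply/hE; constructor 2; left.
  have dpq : det2 p q != 0 by apply: (extreme_det2 hs).
  have [k_eq1|k_neq1] := eqVneq (aspect_ratio Q) 1.
    have hext := extremal_support_square hs HE fE Ep.1 Eq.1 dpq exQ k_eq1.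
    by case: (hexagon_aspect_not_one hs HE fE hE qp rp rq E_neq0 hext).
  right; apply: (weakly_invariant_hexagon hs HE exQ simH _ fE hE) => //.
  by rewrite lt_neqAle k_neq1.
- have fE : finite_set (extreme_points H) by apply/finite_setP; exists 4%N.
  have E_neq0 x : extreme_points H x -> x != 0 by apply: extreme_neq0 En _.
  have [|p [q [p0 q0 qp hE]]] := sym_set4 En (fun x => extremeN hs).
    by move=> /E_neq0; rewrite eqxx.
  have Ep : extreme_points H p by apply/hE; left; left.
  have Eq : extreme_points H q by apply/hE; right; left.
  have dpq : det2 p q != 0 by apply: (extreme_det2 hs).
  have [k_eq1|k_neq1] := eqVneq (aspect_ratio Q) 1.
    have hext := extremal_support_square hs HE fE Ep.1 Eq.1 dpq exQ k_eq1.
    have E0 : extreme_points H !=set0 by exists p.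
    have [e [f [Ee Ef ef ff _]]] := longest_orthogonal fE E0 E_neq0 hext.
    have nef := orthogonal_not_eqpm (E_neq0 _ Ee) ef.
    have {}hE := two_classes hE Ee Ef nef.
    left; rewrite HE (_ : extreme_points H = [set x | eqpm x e \/ eqpm x f]).
      exact: square_hull ef ff (E_neq0 _ Ee).
    by apply/seteqP; split=> x /hE.
  have {}k1 : aspect_ratio Q < 1 by rewrite lt_neqAle k_neq1.
  have [A [a [b [d [lA AH dd ab hA]]]]] := invariant_frame_map hs exQ.1 simH.
  have iA := frame_map_inj lA dd ab hA.
  have AE x : extreme_points H x -> extreme_points H (A x).
    exact: extreme_image lA iA AH.
  (* With only two pairs, every permutation of them makes the square of [A] a sign, which is
     excluded for ratios below one. *)
  have [e ee AA] := two_periodic lA dpq (permute_pairs4 lA iA AE hE qp).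
  by case: (frame_map_no_involution AH dd ab hA hs exQ.1 k1 ee AA).
Qed.
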